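(* Let $(\mathcal A,\mathcal B,\mathcal C)$ be a recollement of abelian categories, with functors $i^*,i_*,i^!,j_!,j^*,j_*$, where $\mathcal B$ has enough projectives and enough injectives and the functors $i^!$ and $j_!$ are exact. Let $(\mathcal U_1,\mathcal V_1)$ and $(\mathcal U_3,\mathcal V_3)$ be tilting cotorsion pairs in $\mathcal A$ and $\mathcal C$ respectively. Assume that $\mathcal U_i\cap\mathcal V_i=\mathrm{add}\,T_i$ for some object $T_i$, for $i=1,3$. Then the glued cotorsion pair $(\mathcal U_2,\mathcal V_2)$ in $\mathcal B$ is a tilting cotorsion pair, and $\mathcal U_2\cap\mathcal V_2$ is the additive closure $\mathrm{add}\,T$ of an $n$-tilting object $T$ of $\mathcal B$ for some $n\ge 1$.
   Context: Standing assumptions: all categories are $k$-linear over a field $k$, Hom-finite and Krull–Schmidt. A subcategory means a full subcategory closed under isomorphisms, finite direct sums and direct summands; $\mathrm{add}\,T$ is the subcategory of direct summands of finite direct sums of copies of $T$. A recollement $(\mathcal A,\mathcal B,\mathcal C)$ of abelian categories consists of additive functors $i_*:\mathcal A\to\mathcal B$, $i^*,i^!:\mathcal B\to\mathcal A$, $j^*:\mathcal B\to\mathcal C$, $j_!,j_*:\mathcal C\to\mathcal B$ such that $(i^*,i_*,i^!)$ and $(j_!,j^*,j_* )$ are adjoint triples, $i_*,j_!,j_*$ are fully faithful, and $\mathrm{Im}\, i_*=\mathrm{Ker}\, j^*$. Under the hypotheses of the claim, $\mathcal A$ and $\mathcal C$ also have enough projectives and enough injectives. Let $\mathcal E$ be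 an abelian category with enough projectives $\mathcal P_{\mathcal E}$ and enough injectives. For a subcategory $\mathcal D$: $\mathcal D^{\bot}=\{X\mid\mathrm{Ext}^i_{\mathcal E}(\mathcal D,X)=0\ \forall i>0\}$, ${}^{\bot_1}\mathcal D=\{X\mid \mathrm{Ext}^1_{\mathcal E}(X,\mathcal D)=0\}$. Put $\mathcal D^{\vee}_0=\mathcal D$; for $i\ge1$, $\mathcal D^{\vee}_i$ consists of the $X$ admitting a short exact sequence $0\to X\to D\to C\to0$ with $D\in\mathcal D$, $C\in\mathcal D^{\vee}_{i-1}$; $\mathcal D^{\vee}=\bigcup_i\mathcal D^{\vee}_i$. A subcategory $\mathcal T$ is $n$-tilting ($n\ge1$) if (P1) all objects of $\mathcal T$ have projective dimension $\le n$; (P2) $\mathrm{Ext}^i_{\mathcal E}(\mathcal T,\mathcal T)=0$ for $i=1,\dots,n$; (P3) every projective $P$ admits short exact sequences $0\to P\to T_0\to R_1\to0$, $0\to R_1\to T_1\to R_2\to0$, …, $0\to R_{n-1}\to T_{n-1}\to T_n\to0$ with all $T_i\in\mathcal T$. An object $T$ is $n$-tilting if $\mathrm{add}\,T$ is an $n$-tilting subcategory. Generalized tilting means $n$-tilting for some $n\ge1$. A pair $(\mathcal U,\mathcal V)$ of subcategories is a cotorsion pair if $\mathrm{Ext}^1_{\mathcal E}(\mathcal U,\mathcal V)=0$ and every $B\in\mathcal E$ admits short exact sequences $0\to V_B\to U_B\to B\to0$ and $0\to B\to V^B\to U^B\to0$ with $U_B,U^B\in\mathcal U$, $V_B,V^B\in\mathcal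 V$. It is hereditary if $\mathrm{Ext}^2_{\mathcal E}(\mathcal U,\mathcal V)=0$. A hereditary cotorsion pair $(\mathcal U,\mathcal V)$ with $\mathcal T=\mathcal U\cap\mathcal V$ is a tilting cotorsion pair if $\mathcal T$ is generalized tilting, $\mathcal U=\mathcal T^{\vee}$ and $\mathcal V=\mathcal T^{\bot}$. Glued cotorsion pair. Given cotorsion pairs $(\mathcal U_1,\mathcal V_1)$ in $\mathcal A$ and $(\mathcal U_3,\mathcal V_3)$ in $\mathcal C$, the glued cotorsion pair in $\mathcal B$ is $(\mathcal U_2,\mathcal V_2)$ with $\mathcal V_2=\{B\in\mathcal B\mid i^!B\in\mathcal V_1,\ j^*B\in\mathcal V_3\}$ and $\mathcal U_2={}^{\bot_1}\mathcal V_2$ (this is a cotorsion pair in $\mathcal B$ under the hypotheses on the recollement). *)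

(* Defs.v *)
From mathcomp Require Import all_boot all_algebra.

Set Implicit Arguments.
Unset Strict Implicit.
Unset Printing Implicit Defensive.

Import GRing.Theory.
Local Open Scope ring_scope.

(* Hom-finite k-linear categories: Hom-spaces are [vectType]s, hence finite
   dimensional over k. *)
Record linCat (k : fieldType) := LinCat {
  Ob :> Type;
  homset : Ob -> Ob -> vectType k;
  idmor : forall X : Ob, homset X X;
  compm : forall X Y Z : Ob, homset Y Z -> homset X Y -> homset X Z;
  compmA : forall (X Y Z W : Ob) (h : homset Z W) (g : homset Y Z) (f : homset X Y),
    compm h (compm g f) = compm (compm h g) f;
  comp_idl : forall (X Y : Ob) (f : homset X Y), compm (idmor Y) f = f;
  comp_idr : forall (X Y : Ob) (f : homset X Y), compm f (idmor X) = f;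
  comp_linearl : forall (X Y Z : Ob) (f : homset X Y),
    linear (fun g : homset Y Z => compm g f);
  comp_linearr : forall (X Y Z : Ob) (g : homset Y Z),
    linear (fun f : homset X Y => compm g f)
}.

Arguments homset {k l} X Y.
Arguments idmor {k l} X.
Arguments compm {k l X Y Z} g f.

Notation "g \oc f" := (compm g f) (at level 40, left associativity).

Section Category.
Variables (k : fieldType) (E : linCat k).
Implicit Types X Y Z : E.

Definition is_iso X Y (f : homset X Y) : Prop :=
  exists g : homset Y X, g \oc f = idmor X /\ f \oc g = idmor Y.

Definition iso_ob X Y : Prop := exists f : homset X Y, is_iso f.

Definition mono X Y (f : homset X Y) : Prop :=
  forall Z (g h : homset Z X), f \oc g = f \oc h -> g = h.

Definition epi X Y (f : homset X Y) : Prop :=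
  forall Z (g h : homset Y Z), g \oc f = h \oc f -> g = h.

(* Initial and terminal: the unique morphism is then the zero one. *)
Definition is_zero X : Prop :=
  forall Y, (forall f : homset X Y, f = 0) /\ (forall f : homset Y X, f = 0).

Definition is_kernel K X Y (f : homset X Y) (u : homset K X) : Prop :=
  f \oc u = 0 /\
  forall Z (g : homset Z X), f \oc g = 0 -> exists! h : homset Z K, u \oc h = g.

Definition is_cokernel X Y C (f : homset X Y) (q : homset Y C) : Prop :=
  q \oc f = 0 /\
  forall Z (g : homset Y Z), g \oc f = 0 -> exists! h : homset C Z, h \oc q = g.

(* Z is a direct sum (biproduct) of X and Y. *)
Definition is_dsum2 X Y Z : Prop :=
  exists (s1 : homset X Z) (s2 : homset Y Z) (p1 : homset Z X) (p2 : homset Z Y),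
    [/\ p1 \oc s1 = idmor X, p2 \oc s2 = idmor Y, p1 \oc s2 = 0, p2 \oc s1 = 0
      & s1 \oc p1 + s2 \oc p2 = idmor Z].

(* S is a direct sum of the F i; for n = 0 this says that S is zero. *)
Definition is_dsum (n : nat) (F : 'I_n -> E) (S : E) : Prop :=
  exists (s : forall i, homset (F i) S) (p : forall i, homset S (F i)),
    [/\ forall i, p i \oc s i = idmor (F i),
        forall i j, i != j -> p i \oc s j = 0
      & \sum_(i < n) s i \oc p i = idmor S].

Definition abelian_cat : Prop :=
  [/\ forall (n : nat) (F : 'I_n -> E), exists S, is_dsum F S,
      forall X Y (f : homset X Y), exists (K : E) (u : homset K X), is_kernel f u,
      forall X Y (f : homset X Y), exists (C : E) (q : homset Y C), is_cokernel f q,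
      forall X Y (f : homset X Y), mono f ->
        exists Z (g : homset Y Z), is_kernel g f
    & forall X Y (f : homset X Y), epi f ->
        exists Z (g : homset Z X), is_cokernel g f].

(* End(X) is a local ring: nonzero, and its non-units are closed under sums. *)
Definition local_end X : Prop :=
  idmor X <> 0 /\
  forall f g : homset X X, is_iso (f + g) -> is_iso f \/ is_iso g.

Definition krull_schmidt : Prop :=
  forall X, exists (n : nat) (F : 'I_n -> E),
    (forall i, local_end (F i)) /\ is_dsum F X.

(* 0 -> X -> Y -> Z -> 0 is exact. *)
Definition ses X Y Z (f : homset X Y) (g : homset Y Z) : Prop :=
  is_kernel g f /\ is_cokernel f g.

(* Im f = Ker g: f factors as an epimorphism followed by a kernel of g. *)
Definition exact_at X Y Z (f : homset X Y) (g : homset Y Z) : Prop :=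
  exists (K : E) (u : homset K Y) (e : homset X K),
    [/\ is_kernel g u, epi e & f = u \oc e].

Definition projective P : Prop :=
  forall Y Z (g : homset Y Z) (f : homset P Z), epi g ->
    exists h : homset P Y, g \oc h = f.

Definition injective_ob I : Prop :=
  forall X Y (g : homset X Y) (f : homset X I), mono g ->
    exists h : homset Y I, h \oc g = f.

Definition enough_projectives : Prop :=
  forall X, exists P (f : homset P X), projective P /\ epi f.

Definition enough_injectives : Prop :=
  forall X, exists I (f : homset X I), injective_ob I /\ mono f.

Record proj_resolution X := ProjResolution {
  pr_ob :> nat -> E;
  pr_d : forall i, homset (pr_ob i.+1) (pr_ob i);
  pr_aug : homset (pr_ob 0%N) X;
  pr_proj : forall i, projective (pr_ob i);
  pr_epi : epi pr_aug;
  pr_exact0 : exact_at (pr_d 0) pr_aug;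
  pr_exact : forall i, exact_at (pr_d i.+1) (pr_d i)
}.

Definition cocycle X (P : proj_resolution X) Y i (f : homset (P i) Y) : Prop :=
  f \oc pr_d P i = 0.

Definition coboundary X (P : proj_resolution X) Y i : homset (P i) Y -> Prop :=
  match i return homset (P i) Y -> Prop with
  | 0%N => fun f => f = 0
  | j.+1 => fun f => exists g : homset (P j) Y, f = g \oc pr_d P j
  end.

(* Ext^i(X, Y) = 0, where Ext^i(X, Y) = H^i(Hom(P, Y)) for a projective
   resolution P of X; Ext does not depend on P.  This is only meaningful when
   X has a projective resolution. *)
Definition ext_zero i X Y : Prop :=
  forall (P : proj_resolution X) (f : homset (P i) Y),
    cocycle f -> coboundary f.

Definition pd_le X (n : nat) : Prop :=
  exists P : proj_resolution X, forall i, (n < i)%N -> is_zero (P i).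

(* Full subcategories are given by their predicate on objects. *)
Implicit Types D U V T : E -> Prop.

Definition summand X Y : Prop := exists X', is_dsum2 X X' Y.

Definition is_subcat D : Prop :=
  [/\ forall X Y, iso_ob X Y -> D X -> D Y,
      forall (n : nat) (F : 'I_n -> E) S,
        (forall i, D (F i)) -> is_dsum F S -> D S
    & forall X Y, summand X Y -> D Y -> D X].

Definition add_closure (T : E) : E -> Prop := fun X =>
  exists (n : nat) (S : E), is_dsum (fun _ : 'I_n => T) S /\ summand X S.

Definition subcat_eq D D' : Prop := forall X, D X <-> D' X.

Definition subcat_cap D D' : E -> Prop := fun X => D X /\ D' X.

Definition right_perp D : E -> Prop := fun X =>
  forall Y, D Y -> forall i, (0 < i)%N -> ext_zero i Y X.

Definition left_perp1 D : E -> Prop := fun X =>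
  forall Y, D Y -> ext_zero 1 X Y.

Fixpoint vee_n D (i : nat) : E -> Prop := fun X =>
  match i with
  | 0%N => D X
  | j.+1 => exists (Y C : E) (f : homset X Y) (g : homset Y C),
      [/\ D Y, vee_n D j C & ses f g]
  end.

Definition vee D : E -> Prop := fun X => exists i, vee_n D i X.

(* In the last clause R i is the i-th cosyzygy, so that R 0 = P, and R n is
   the last term T_n of the chain. *)
Definition n_tilting (n : nat) T : Prop :=
  [/\ (0 < n)%N,
      is_subcat T,
      forall X, T X -> pd_le X n,
      forall X Y, T X -> T Y -> forall i, (1 <= i <= n)%N -> ext_zero i X Y
    & forall P, projective P ->
        exists R T' : nat -> E,
          [/\ R 0%N = P,
              forall i, (i < n)%N -> T (T' i),
              forall i, (i < n)%N ->
                exists (f : homset (R i) (T' i)) (g : homset (T' i) (R i.+1)),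
                  ses f g
            & T (R n)]].

Definition n_tilting_object (n : nat) (T : E) : Prop :=
  n_tilting n (add_closure T).

Definition generalized_tilting T : Prop := exists n, n_tilting n T.

Definition cotorsion_pair U V : Prop :=
  [/\ is_subcat U, is_subcat V,
      forall X Y, U X -> V Y -> ext_zero 1 X Y,
      forall B, exists (V_B U_B : E) (f : homset V_B U_B) (g : homset U_B B),
        [/\ V V_B, U U_B & ses f g]
    & forall B, exists (V_B U_B : E) (f : homset B V_B) (g : homset V_B U_B),
        [/\ V V_B, U U_B & ses f g]].

Definition hereditary U V : Prop :=
  forall X Y, U X -> V Y -> ext_zero 2 X Y.

Definition tilting_cotorsion_pair U V : Prop :=
  [/\ cotorsion_pair U V,
      hereditary U V,
      generalized_tilting (subcat_cap U V),
      subcat_eq U (vee (subcat_cap U V))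
    & subcat_eq V (right_perp (subcat_cap U V))].

End Category.

Record addFunctor (k : fieldType) (A B : linCat k) := AddFunctor {
  fobj :> A -> B;
  fmap : forall X Y : A, homset X Y -> homset (fobj X) (fobj Y);
  fmap_id : forall X : A, fmap (idmor X) = idmor (fobj X);
  fmap_comp : forall (X Y Z : A) (g : homset Y Z) (f : homset X Y),
    fmap (g \oc f) = fmap g \oc fmap f;
  fmapD : forall (X Y : A) (f g : homset X Y), fmap (f + g) = fmap f + fmap g
}.

Arguments fmap {k A B} a {X Y} f.

Section Functors.
Variables (k : fieldType) (A B : linCat k).

Definition adjoint (F : addFunctor A B) (G : addFunctor B A) : Prop :=
  exists phi : forall (X : A) (Y : B), homset (F X) Y -> homset X (G Y),
    (forall X Y, bijective (@phi X Y)) /\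
    (forall (X' X : A) (Y Y' : B) (f : homset X' X) (g : homset Y Y')
       (h : homset (F X) Y),
       phi X' Y' (g \oc h \oc fmap F f) = fmap G g \oc phi X Y h \oc f).

Definition fully_faithful (F : addFunctor A B) : Prop :=
  forall X Y : A, bijective (@fmap k A B F X Y).

Definition exact_functor (F : addFunctor A B) : Prop :=
  forall (X Y Z : A) (f : homset X Y) (g : homset Y Z),
    ses f g -> ses (fmap F f) (fmap F g).

End Functors.

Record recollement (k : fieldType) (A B C : linCat k) := Recollement {
  i_upstar : addFunctor B A;     (* i^* *)
  i_lowstar : addFunctor A B;    (* i_* *)
  i_upshriek : addFunctor B A;   (* i^! *)
  j_lowshriek : addFunctor C B;  (* j_! *)
  j_upstar : addFunctor B C;     (* j^* *)
  j_lowstar : addFunctor C B;    (* j_* *)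
  i_adj1 : adjoint i_upstar i_lowstar;
  i_adj2 : adjoint i_lowstar i_upshriek;
  j_adj1 : adjoint j_lowshriek j_upstar;
  j_adj2 : adjoint j_upstar j_lowstar;
  i_lowstar_ff : fully_faithful i_lowstar;
  j_lowshriek_ff : fully_faithful j_lowshriek;
  j_lowstar_ff : fully_faithful j_lowstar;
  im_i_ker_j : forall Y : B,
    (exists X : A, iso_ob (i_lowstar X) Y) <-> is_zero (j_upstar Y)
}.

Definition glued_V (k : fieldType) (A B C : linCat k) (R : recollement A B C)
    (V1 : A -> Prop) (V3 : C -> Prop) : B -> Prop :=
  fun Y => V1 (i_upshriek R Y) /\ V3 (j_upstar R Y).

Definition glued_U (k : fieldType) (A B C : linCat k) (R : recollement A B C)
    (V1 : A -> Prop) (V3 : C -> Prop) : B -> Prop :=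
  left_perp1 (glued_V R V1 V3).

(* Main.v *)
Require Import Defs.
From mathcomp Require Import all_boot all_algebra.
From Stdlib Require Import IndefiniteDescription.

(* Since i^! is exact, so is j_*; hence A and C inherit enough projectives and
   injectives, and for the exact adjoint functors i_*, i^! and j_!, j^* we
   have Ext^n(i_*M, Y) = Ext^n(M, i^!Y) and Ext^n(j_!N, Y) = Ext^n(N, j^*Y).
   Pushing special preenvelopes out along the counits of these two pairs turns
   them into special V2-preenvelopes in B, whose cokernels are extensions of
   some i_*M by some j_!N with M in U1 and N in U3; so (U2, V2) is a cotorsion
   pair, every object of U2 is a summand of an extension of such a cokernel by
   a projective, and both the vanishing of Ext^n(U2, V2) and a uniform bound on
   the projective dimension of U2 follow from those for U1 and U3.  A cotorsion
   pair with these two properties is tilting as soon as the objects right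
   orthogonal to its kernel T2 lie in V2, which is again checked through i^! and
   j^*.  Finally let K in T2 be a special preenvelope of j_!T3 with cokernel in
   i_*U1: every Y in T2 receives a split epimorphism from a finite direct sum of
   copies of K and an object of i_*(add T1), so T2 = add (K + i_*T1). *)

Set Implicit Arguments.
Unset Strict Implicit.
Unset Printing Implicit Defensive.

Import GRing.Theory.
Local Open Scope ring_scope.

(** * Additive and abelian categories *)

Section Additivity.
Variables (k : fieldType) (E : linCat k).
Implicit Types X Y Z W : E.

Lemma compDl X Y Z (f : homset X Y) (g h : homset Y Z) :
  (g + h) \oc f = g \oc f + h \oc f.
Proof. by have := comp_linearl f 1 g h; rewrite !scale1r. Qed.

Lemma compDr X Y Z (g : homset Y Z) (f h : homset X Y) :
  g \oc (f + h) = g \oc f + g \oc h.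
Proof. by have := comp_linearr g 1 f h; rewrite !scale1r. Qed.

Lemma comp0l X Y Z (f : homset X Y) : (0 : homset Y Z) \oc f = 0.
Proof. by apply: (addrI (0 \oc f)); rewrite -compDl !addr0. Qed.

Lemma comp0r X Y Z (g : homset Y Z) : g \oc (0 : homset X Y) = 0.
Proof. by apply: (addrI (g \oc 0)); rewrite -compDr !addr0. Qed.

Lemma compNl X Y Z (f : homset X Y) (g : homset Y Z) : (- g) \oc f = - (g \oc f).
Proof. by apply: (addrI (g \oc f)); rewrite -compDl !subrr comp0l. Qed.

Lemma compNr X Y Z (f : homset X Y) (g : homset Y Z) : g \oc (- f) = - (g \oc f).
Proof. by apply: (addrI (g \oc f)); rewrite -compDr !subrr comp0r. Qed.

Lemma compBl X Y Z (f : homset X Y) (g h : homset Y Z) :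
  (g - h) \oc f = g \oc f - h \oc f.
Proof. by rewrite compDl compNl. Qed.

Lemma compBr X Y Z (g : homset Y Z) (f h : homset X Y) :
  g \oc (f - h) = g \oc f - g \oc h.
Proof. by rewrite compDr compNr. Qed.

Lemma comp_suml X Y Z (I : Type) (r : seq I) (F : I -> homset Y Z) (f : homset X Y) :
  (\sum_(i <- r) F i) \oc f = \sum_(i <- r) (F i \oc f).
Proof.
by elim: r => [|i r IH]; rewrite ?big_nil ?comp0l // !big_cons compDl IH.
Qed.

Lemma comp_sumr X Y Z (I : Type) (r : seq I) (F : I -> homset X Y) (g : homset Y Z) :
  g \oc (\sum_(i <- r) F i) = \sum_(i <- r) (g \oc F i).
Proof.
by elim: r => [|i r IH]; rewrite ?big_nil ?comp0r // !big_cons compDr IH.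
Qed.

Lemma comp_eq X Y Z W (g : homset Y Z) (f : homset X Y) r (H : g \oc f = r)
  (x : homset Z W) : x \oc g \oc f = x \oc r.
Proof. by rewrite -compmA H. Qed.

(** Hom-spaces are swapped definitionally, so a dual statement is the original one instantiated at
    [opcat E] and read back by conversion. *)
Definition opcat : linCat k :=
  @LinCat k (Ob E) (fun X Y : E => homset Y X) (@idmor k E)
    (fun X Y Z (g : homset Z Y) (f : homset Y X) => f \oc g)
    (fun X Y Z W (h : homset W Z) (g : homset Z Y) (f : homset Y X) =>
       esym (compmA f g h))
    (fun X Y f => comp_idr f) (fun X Y f => comp_idl f)
    (fun X Y Z f => comp_linearr f) (fun X Y Z g => comp_linearl g).

Lemma is_dsum_op n (F : 'I_n -> E) S : is_dsum F S -> is_dsum (F : 'I_n -> opcat) S.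
Proof.
case=> s [p [ps pns sp]]; exists p, s; split=> //= i j nij.
by apply: pns; rewrite eq_sym.
Qed.

Lemma abelian_op : abelian_cat E -> abelian_cat opcat.
Proof.
case=> ds ker coker mk ec; split.
- by move=> n F; have [S dS] := ds n F; exists S; apply: is_dsum_op.
- by move=> X Y f; apply: coker.
- by move=> X Y f; apply: ker.
- by move=> X Y f; apply: ec.
- by move=> X Y f; apply: mk.
Qed.

End Additivity.

Lemma ses_op (k : fieldType) (E : linCat k) (X Y Z : E) (f : homset X Y)
  (g : homset Y Z) : ses f g -> ses (E := opcat E) (g : homset (Z : opcat E) Y) f.
Proof. by case. Qed.

Section Abelian.
Variables (k : fieldType) (E : linCat k).
Hypothesis abE : abelian_cat E.
Implicit Types X Y Z W : E.

Lemma epi0 X Y (f : homset X Y) :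
  (forall Z (g : homset Y Z), g \oc f = 0 -> g = 0) -> epi f.
Proof.
move=> H Z g h e; apply/eqP; rewrite -subr_eq0; apply/eqP/H.
by rewrite compBl e subrr.
Qed.

Lemma mono0 X Y (f : homset X Y) :
  (forall Z (g : homset Z X), f \oc g = 0 -> g = 0) -> mono f.
Proof.
move=> H Z g h e; apply/eqP; rewrite -subr_eq0; apply/eqP/H.
by rewrite compBr e subrr.
Qed.

Lemma epi_eq0 X Y Z (f : homset X Y) (g : homset Y Z) : epi f -> g \oc f = 0 -> g = 0.
Proof. by move=> ef e; apply: ef; rewrite e comp0l. Qed.

Lemma mono_eq0 X Y Z (f : homset X Y) (g : homset Z X) : mono f -> f \oc g = 0 -> g = 0.
Proof. by move=> ef e; apply: ef; rewrite e comp0r. Qed.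

Lemma mono_comp X Y Z (g : homset Y Z) (f : homset X Y) : mono g -> mono f -> mono (g \oc f).
Proof. by move=> mg mf W a b; rewrite -!compmA => /mg/mf. Qed.

Lemma epi_comp X Y Z (g : homset Y Z) (f : homset X Y) : epi g -> epi f -> epi (g \oc f).
Proof. by move=> mg mf W a b; rewrite !compmA => /mf/mg. Qed.

Lemma mono_compr X Y Z (g : homset Y Z) (f : homset X Y) : mono (g \oc f) -> mono f.
Proof. by move=> m W a b e; apply: m; rewrite -!compmA e. Qed.

Lemma epi_compl X Y Z (g : homset Y Z) (f : homset X Y) : epi (g \oc f) -> epi g.
Proof. by move=> m W a b e; apply: m; rewrite !compmA e. Qed.

Lemma mono_retract X Y (f : homset X Y) (r : homset Y X) : r \oc f = idmor X -> mono f.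
Proof.
move=> e; apply: (@mono_compr _ _ _ r); rewrite e => Z a b; by rewrite !comp_idl.
Qed.

Lemma epi_section X Y (f : homset X Y) (s : homset Y X) : f \oc s = idmor Y -> epi f.
Proof.
move=> e; apply: (@epi_compl _ _ _ _ s); rewrite e => Z a b; by rewrite !comp_idr.
Qed.

Lemma kernel_mono X Y Z (f : homset X Y) (g : homset Y Z) : is_kernel g f -> mono f.
Proof.
case=> e u; apply: mono0 => W h fh; have [|m [_ um]] := u W 0; first exact: comp0r.
by rewrite -(um h) // -(um 0) // comp0r.
Qed.

Lemma cokernel_epi X Y Z (f : homset X Y) (g : homset Y Z) : is_cokernel f g -> epi g.
Proof.
case=> e u; apply: epi0 => W h fh; have [|m [_ um]] := u W 0; first exact: comp0l.
by rewrite -(um h) // -(um 0) // comp0l.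
Qed.

Lemma kernelI X Y Z (f : homset X Y) (g : homset Y Z) :
  mono f -> g \oc f = 0 ->
  (forall W (h : homset W Y), g \oc h = 0 -> exists m, f \oc m = h) -> is_kernel g f.
Proof.
move=> mf e H; split=> // W h gh; have [m em] := H W h gh.
by exists m; split=> // m' em'; apply: mf; rewrite em em'.
Qed.

Lemma cokernelI X Y Z (f : homset X Y) (g : homset Y Z) :
  epi g -> g \oc f = 0 ->
  (forall W (h : homset Y W), h \oc f = 0 -> exists m, m \oc g = h) -> is_cokernel f g.
Proof.
move=> mf e H; split=> // W h gh; have [m em] := H W h gh.
by exists m; split=> // m' em'; apply: mf; rewrite em em'.
Qed.

Lemma kernelE X Y Z W (f : homset X Y) (g : homset Y Z) (h : homset W Y) :
  is_kernel g f -> g \oc h = 0 -> exists m, f \oc m = h.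
Proof. by case=> _ u /u [m [em _]]; exists m. Qed.

Lemma cokernelE X Y Z W (f : homset X Y) (g : homset Y Z) (h : homset Y W) :
  is_cokernel f g -> h \oc f = 0 -> exists m, m \oc g = h.
Proof. by case=> _ u /u [m [em _]]; exists m. Qed.

Lemma ses_mono X Y Z (f : homset X Y) (g : homset Y Z) : ses f g -> mono f.
Proof. by case=> /kernel_mono. Qed.

Lemma ses_epi X Y Z (f : homset X Y) (g : homset Y Z) : ses f g -> epi g.
Proof. by case=> _ /cokernel_epi. Qed.

Lemma ses0 X Y Z (f : homset X Y) (g : homset Y Z) : ses f g -> g \oc f = 0.
Proof. by case=> [[]]. Qed.

Lemma kernel_ex X Y (f : homset X Y) : exists (K : E) (u : homset K X), is_kernel f u.
Proof. by case: abE => _ H _ _ _; apply: H. Qed.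

Lemma cokernel_ex X Y (f : homset X Y) : exists (C : E) (q : homset Y C), is_cokernel f q.
Proof. by case: abE => _ _ H _ _; apply: H. Qed.

(** A mono is the kernel of some [h], and [h] factors through the cokernel [g]; hence whatever [g]
    kills is killed by [h] and lifts through [f]. *)
Lemma mono_ses X Y Z (f : homset X Y) (g : homset Y Z) : mono f -> is_cokernel f g -> ses f g.
Proof.
move=> mf cg; split=> //; case: abE => _ _ _ H _.
have [W [h kh]] := H _ _ f mf; have [hf _] := kh.
have [m em] := cokernelE cg hf; apply: kernelI => //; first by case: cg.
by move=> V x gx; apply: (kernelE kh); rewrite -em -compmA gx comp0r.
Qed.

Lemma epi_ses X Y Z (f : homset X Y) (g : homset Y Z) : epi g -> is_kernel g f -> ses f g.
Proof.
move=> mf cg; split=> //; case: abE => _ _ _ _ H.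
have [W [h kh]] := H _ _ g mf; have [hf _] := kh.
have [m em] := kernelE cg hf; apply: cokernelI => //; first by case: cg.
by move=> V x gx; apply: (cokernelE kh); rewrite -em compmA gx comp0l.
Qed.

Lemma mono_ses_ex X Y (f : homset X Y) : mono f -> exists (Z : E) (g : homset Y Z), ses f g.
Proof.
by move=> mf; have [Z [g cg]] := cokernel_ex f; exists Z, g; apply: mono_ses.
Qed.

Lemma epi_ses_ex Y Z (g : homset Y Z) : epi g -> exists (X : E) (f : homset X Y), ses f g.
Proof.
by move=> eg; have [X [f kf]] := kernel_ex g; exists X, f; apply: epi_ses.
Qed.

Lemma mono_epi_iso X Y (f : homset X Y) : mono f -> epi f -> is_iso f.
Proof.
move=> mf ef; have [Z [g s]] := mono_ses_ex mf.
have g0 : g = 0 by apply: (epi_eq0 ef); apply: ses0 s.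
have [|m em] := @kernelE _ _ _ _ f g (idmor Y) s.1.
  by rewrite g0 comp0l.
exists m; split=> //; apply: mf; by rewrite compmA em comp_idl comp_idr.
Qed.

Lemma is_zeroP X : idmor X = 0 -> is_zero X.
Proof.
by move=> e Y; split=> f; rewrite -[f]comp_idl -[f]comp_idr ?e ?comp0l ?comp0r // comp_idl e comp0l.
Qed.

Lemma dsum2_ex X Y : exists Z, is_dsum2 X Y Z.
Proof.
case: abE => H _ _ _ _.
pose F (i : 'I_2) : E := if val i is 0%N then X else Y.
have [S [s [p [ps pns sp]]]] := H 2%N F; exists S.
exists (s ord0), (s (lift ord0 ord0)), (p ord0), (p (lift ord0 ord0)).
split; [exact: (ps ord0) | exact: (ps (lift ord0 ord0))
  | exact: (pns ord0 (lift ord0 ord0) isT) | exact: (pns (lift ord0 ord0) ord0 isT) |].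
by rewrite -sp !big_ord_recl big_ord0 addr0.
Qed.

Lemma zero_ex : exists Z : E, is_zero Z.
Proof.
case: abE => H _ _ _ _.
have [S [s [p [_ _ e]]]] := H 0%N (fun i => False_rect E (notF (ltn_ord i))).
by exists S; apply: is_zeroP; rewrite -e big_ord0.
Qed.

End Abelian.

(** * Pullbacks, retracts and the short five lemma *)

Section Constructions.
Variables (k : fieldType) (E : linCat k).
Hypothesis abE : abelian_cat E.
Implicit Types X Y Z W : E.

(** When [f] is already epi on the summand [T], each element of [M] can be corrected by [T] to lie
    in the kernel of [f], uniquely up to [V]. This serves both for pullbacks and, at the end, for
    the kernel of an approximation defined on a direct sum. *)
Lemma dsum2_kernel_ses M T D L V Z (s1 : homset M D) (s2 : homset T D)
  (p1 : homset D M) (p2 : homset D T) (f : homset D L) (v : homset V T) (z : homset Z D) :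
  p1 \oc s1 = idmor M -> p2 \oc s2 = idmor T -> p1 \oc s2 = 0 ->
  s1 \oc p1 + s2 \oc p2 = idmor D ->
  ses v (f \oc s2) -> is_kernel f z ->
  exists c : homset V Z, z \oc c = s2 \oc v /\ ses c (p1 \oc z).
Proof.
move=> h1 h2 h3 h5 sv kz.
have [|c ec] := kernelE (h := s2 \oc v) kz; first by rewrite compmA (ses0 sv).
exists c; split=> //.
have ef : epi f by apply: epi_compl; exact: ses_epi sv.
have ms2 : mono s2 by apply: mono_retract h2.
apply: epi_ses => //.
  apply: epi0 => W h e.
  (* Since [f] is the cokernel of [z], the map [h \oc p1] is some [w \oc f]; it vanishes on the
     summand [T], which forces [w] to be zero. *)
  have [w ew] := cokernelE (epi_ses abE ef kz).2 (h := h \oc p1) (etrans (esym (compmA _ _ _)) e).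
  have w0 : w = 0.
    apply: (epi_eq0 (ses_epi sv)); rewrite compmA ew -compmA h3; exact: comp0r.
  by rewrite -[h]comp_idr -h1 compmA -ew w0 !comp0l.
apply: kernelI.
- by apply: (@mono_compr _ _ _ _ _ z); rewrite ec; apply: mono_comp (ses_mono sv).
- by rewrite -compmA ec compmA h3 comp0l.
move=> W x px.
have zx : z \oc x = s2 \oc (p2 \oc z \oc x).
  by rewrite -[LHS]comp_idl -h5 compDl -!compmA [p1 \oc _]compmA px comp0r add0r.
have [|y ey] := kernelE (h := p2 \oc z \oc x) sv.1.
  by rewrite -compmA -zx compmA kz.1 comp0l.
exists y; apply: (kernel_mono kz).
by rewrite compmA ec -compmA ey zx.
Qed.

Lemma pullback_ses V T L M (v : homset V T) (t : homset T L) (a : homset M L) :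
  ses v t ->
  exists Z (c : homset V Z) (p : homset Z M) (b : homset Z T),
    [/\ ses c p, t \oc b = a \oc p, b \oc c = v
      & forall W (x : homset W M) (y : homset W T), a \oc x = t \oc y ->
          exists h, p \oc h = x /\ b \oc h = y].
Proof.
move=> sv; have [D [s1 [s2 [p1 [p2 [h1 h2 h3 h4 h5]]]]]] := dsum2_ex abE M T.
(* The kernel of this difference is the pullback of [a] and [t]. *)
pose f := t \oc p2 - a \oc p1.
have fs2 : f \oc s2 = t by rewrite compBl -!compmA h2 h3 comp0r subr0 comp_idr.
have fs1 : f \oc s1 = - a by rewrite compBl -!compmA h1 h4 comp0r sub0r comp_idr.
have [Z [z kz]] := kernel_ex abE f.
have [|c [ec sc]] := dsum2_kernel_ses (v := v) h1 h2 h3 h5 _ kz; first by rewrite fs2.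
exists Z, c, (p1 \oc z), (p2 \oc z); split=> //.
- by apply/eqP; rewrite -subr_eq0 !compmA -compBl kz.1.
- by rewrite -compmA ec compmA h2 comp_idl.
move=> W x y e; have [|h eh] := kernelE (h := s1 \oc x + s2 \oc y) kz.
  by rewrite compDr !compmA fs1 fs2 compNl e addNr.
exists h; rewrite -!compmA eh !compDr !compmA h1 h2 h3 h4 !comp_idl !comp0l.
by rewrite addr0 add0r.
Qed.

(** The kernel of [g \oc p] is the pullback of [f] along [p]. The dual statement computes the
    cokernel when two preenvelopes are composed. *)
Lemma kernel_comp_ses K P X X1 X2 (u : homset K P) (p : homset P X)
  (f : homset X1 X) (g : homset X X2) :
  ses u p -> ses f g ->
  exists W (a : homset K W) (b : homset W X1) (w : homset W P),
    [/\ ses a b, ses w (g \oc p), w \oc a = u & p \oc w = f \oc b].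
Proof.
move=> su sf; have [W [a [b [w [sa e1 e2 H]]]]] := pullback_ses f su.
exists W, a, b, w; split=> //; apply: epi_ses => //.
  by apply: epi_comp; [exact: ses_epi sf | exact: ses_epi su].
apply: kernelI.
- apply: mono0 => V h wh.
  have bh : b \oc h = 0.
    by apply: (mono_eq0 (ses_mono sf)); rewrite compmA -e1 -compmA wh comp0r.
  have [m em] := kernelE sa.1 bh.
  have m0 : m = 0 by apply: (mono_eq0 (ses_mono su)); rewrite -e2 -compmA em.
  by rewrite -em m0 comp0r.
- by rewrite -compmA e1 compmA (ses0 sf) comp0l.
move=> V h gh; have [|m em] := kernelE (h := p \oc h) sf.1; first by rewrite compmA.
by have [n [_ en]] := H V m h em; exists n.
Qed.

(** In an abelian category this agrees with [summand], the complement being the kernel of the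
    retraction, and it is easier to produce and compose with. *)
Definition retract_of X Z := exists (s : homset X Z) (r : homset Z X), r \oc s = idmor X.

Lemma split_dsum2 K X Z (u : homset K Z) (r : homset Z X) (s : homset X Z) :
  is_kernel r u -> r \oc s = idmor X -> is_dsum2 X K Z.
Proof.
move=> ku rs; have [|q eq] := kernelE (h := idmor Z - s \oc r) ku.
  by rewrite compBr compmA rs comp_idl comp_idr subrr.
have mu := kernel_mono ku.
exists s, u, r, q; split=> //.
- by apply: mu; rewrite compmA eq compBl -compmA ku.1 comp0r subr0 comp_idl comp_idr.
- by case: ku.
- by apply: (mono_eq0 mu); rewrite compmA eq compBl -compmA rs comp_idl comp_idr subrr.
by rewrite eq addrC subrK.
Qed.

Lemma retract_summand X Z : retract_of X Z -> summand X Z.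
Proof.
move=> [s [r rs]]; have [K [u ku]] := kernel_ex abE r.
by exists K; apply: split_dsum2 ku rs.
Qed.

Lemma summand_retract X Z : summand X Z -> retract_of X Z.
Proof. by case=> X' [s1 [s2 [p1 [p2 []]]]]; exists s1, p1. Qed.

Lemma iso_retract X Y : iso_ob X Y -> retract_of Y X.
Proof. by case=> f [g [e1 e2]]; exists g, f. Qed.

Lemma split_kernel_retract K X Z (u : homset K Z) (r : homset Z X) (s : homset X Z) :
  is_kernel r u -> r \oc s = idmor X -> retract_of K Z.
Proof.
move=> ku rs; have [s1 [s2 [p1 [p2 [_ h _ _ _]]]]] := split_dsum2 ku rs.
by exists s2, p2.
Qed.

Lemma section_retraction X Y Z (f : homset X Y) (g : homset Y Z) (s : homset Z Y) :
  ses f g -> g \oc s = idmor Z -> exists r, r \oc f = idmor X.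
Proof.
move=> sf gs; have [|r er] := kernelE (h := idmor Y - s \oc g) sf.1.
  by rewrite compBr compmA gs comp_idl comp_idr subrr.
exists r; apply: (ses_mono sf).
by rewrite compmA er compBl -compmA (ses0 sf) comp0r subr0 comp_idl comp_idr.
Qed.

Lemma five_iso X Y Z X' Y' Z' (f : homset X Y) (g : homset Y Z)
  (f' : homset X' Y') (g' : homset Y' Z') (a : homset X X') (b : homset Y Y')
  (c : homset Z Z') :
  ses f g -> ses f' g' -> b \oc f = f' \oc a -> g' \oc b = c \oc g ->
  is_iso a -> is_iso c -> is_iso b.
Proof.
move=> sf sf' e1 e2 [a' [ha ha']] [c' [hc hc']].
apply: mono_epi_iso => //.
  apply: mono0 => W h bh.
  have gh : g \oc h = 0.
    rewrite -[g]comp_idl -hc -(compmA c') -e2 -!compmA bh !comp0r //.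
  have [m em] := kernelE sf.1 gh; rewrite -em.
  suff -> : m = 0 by rewrite comp0r.
  have : f' \oc (a \oc m) = 0 by rewrite compmA -e1 -compmA em.
  move/(mono_eq0 (ses_mono sf')) => am.
  by rewrite -[m]comp_idl -ha -compmA am comp0r.
apply: epi0 => W h hb.
have hf : h \oc f' = 0.
  by rewrite -[f']comp_idr -ha' (compmA f') -e1 !compmA hb !comp0l.
have [m em] := cokernelE sf'.2 hf; rewrite -em.
suff -> : m = 0 by rewrite comp0l.
have : m \oc c \oc g = 0 by rewrite -compmA -e2 compmA em.
move/(epi_eq0 (ses_epi sf)) => am.
by rewrite -[m]comp_idr -hc' compmA am comp0l.
Qed.

Lemma iso_ses X Y Z Y' (f : homset X Y) (g : homset Y Z) (h : homset Y' Y) (h' : homset Y Y') :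
  h' \oc h = idmor Y' -> h \oc h' = idmor Y -> ses f g -> ses (h' \oc f) (g \oc h).
Proof.
move=> e1 e2 sf.
have mh' := mono_retract e2; have eh := epi_section e2.
apply: epi_ses => //; first by apply: epi_comp eh; exact: ses_epi sf.
apply: kernelI.
- by apply: mono_comp => //; exact: ses_mono sf.
- by rewrite !compmA (comp_eq e2) comp_idr (ses0 sf).
move=> W x gx; have [|m em] := kernelE (h := h \oc x) sf.1; first by rewrite compmA.
by exists m; rewrite -compmA em compmA e1 comp_idl.
Qed.

End Constructions.

(** * Pushouts and other dual constructions *)

Section Pushouts.
Variables (k : fieldType) (E : linCat k).
Hypothesis abE : abelian_cat E.
Implicit Types X Y Z W : E.

Lemma pushout_ses V T L M (v : homset L T) (t : homset T V) (a : homset L M) :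
  ses v t ->
  exists (Z : E) (c : homset M Z) (p : homset Z V) (b : homset T Z),
    [/\ ses c p, b \oc v = c \oc a, p \oc b = t
      & forall W (x : homset M W) (y : homset T W), x \oc a = y \oc v ->
          exists h, h \oc c = x /\ h \oc b = y].
Proof.
move=> sv.
have [Z [c [p [b [s e1 e2 H]]]]] :=
  @pullback_ses k (opcat E) (abelian_op abE) V T L M t v a (ses_op sv).
by exists Z, p, c, b; split=> //; apply: ses_op s.
Qed.

Lemma cokernel_comp_ses Q P X X1 X2 (u : homset P Q) (p : homset X P)
  (f : homset X X1) (g : homset X2 X) :
  ses p u -> ses g f ->
  exists (W : E) (a : homset W Q) (b : homset X1 W) (w : homset P W),
    [/\ ses b a, ses (p \oc g) w, a \oc w = u & w \oc p = b \oc f].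
Proof.
move=> su sf.
have [W [a [b [w [h1 h2 h3 h4]]]]] :=
  @kernel_comp_ses k (opcat E) (abelian_op abE) Q P X X1 X2 u p f g (ses_op su) (ses_op sf).
by exists W, a, b, w; split=> //; [exact: ses_op h1 | exact: ses_op h2].
Qed.

Lemma retraction_section (X Y Z : E) (f : homset X Y) (g : homset Y Z) (r : homset Y X) :
  ses f g -> r \oc f = idmor X -> exists s, g \oc s = idmor Z.
Proof.
move=> sf rf; exact: (@section_retraction k (opcat E) Z Y X g f r (ses_op sf) rf).
Qed.

End Pushouts.

(** * Vanishing of Ext by dimension shifting *)

(* [extv i X Y] says that Ext^(i+1)(X, Y) = 0. *)
Section ExtVanishing.
Variables (k : fieldType) (E : linCat k).
Implicit Types X Y Z W : E.

Definition syzygy X K := exists (P : E) (u : homset K P) (p : homset P X),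
  projective P /\ ses u p.

Definition cosyzygy X Y := exists (I : E) (u : homset X I) (p : homset I Y),
  injective_ob I /\ ses u p.

Fixpoint extv i X Y : Prop :=
  match i with
  | 0 => forall M (a : homset Y M) (b : homset M X), ses a b ->
      exists s, b \oc s = idmor X
  | j.+1 => forall K, syzygy X K -> extv j K Y
  end.

End ExtVanishing.

Section Ext1.
Variables (k : fieldType) (E : linCat k).
Hypothesis abE : abelian_cat E.
Implicit Types X Y Z W : E.

(** Splitting is self-dual, a section providing a retraction; this carries the facts on Ext^1 over
    to the opposite category. *)
Lemma extv0_op X Y : extv 0 X Y -> extv (E := opcat E) 0 Y X.
Proof.
move=> H M a b sab; have sab' : @ses k E Y M X b a by apply: ses_op sab.
have [s bs] := H M b a sab'.
exact: (@section_retraction k E Y M X b a s sab' bs).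
Qed.

(** A section of the extension pulled back along [f] is a lift of [f]. *)
Lemma extv0_lift X Y M N (a : homset Y M) (b : homset M N) (f : homset X N) :
  extv 0 X Y -> ses a b -> exists h, b \oc h = f.
Proof.
move=> H sab; have [Z [c [p [q [scp e _ _]]]]] := pullback_ses abE f sab.
have [s ps] := H _ _ _ scp; exists (q \oc s).
by rewrite compmA e -compmA ps comp_idr.
Qed.

(** Lift [p] to [q] with values in the extension. Its restriction to [K] lands in [Y] and extends to
    [P]; subtracting the extension from [q] leaves a map that descends to a section on [X]. *)
Lemma extv0_proj X Y K P (u : homset K P) (p : homset P X) :
  projective P -> ses u p -> (forall f : homset K Y, exists h, h \oc u = f) ->
  extv 0 X Y.
Proof.
move=> pP sup H M a b sab; have [q bq] := pP _ _ b p (ses_epi sab).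
have [|f ef] := kernelE (h := q \oc u) sab.1; first by rewrite compmA bq (ses0 sup).
have [h hu] := H f.
have [|s es] := cokernelE (h := q - a \oc h) sup.2.
  by rewrite compBl -compmA hu ef subrr.
exists s; apply: (ses_epi sup).
by rewrite -compmA es compBr compmA (ses0 sab) comp0l subr0 bq comp_idl.
Qed.

Lemma projective_extv0 P Y : projective P -> extv 0 P Y.
Proof. by move=> pP M a b sab; apply: (pP _ _ b (idmor P)); exact: ses_epi sab. Qed.

Lemma extv0_projective X : (forall Y, extv 0 X Y) -> projective X.
Proof.
move=> H Y Z g f eg; have [K [u sug]] := epi_ses_ex abE eg.
by apply: extv0_lift sug; exact: H.
Qed.

Lemma extv0_retract X Z Y : retract_of X Z -> extv 0 Z Y -> extv 0 X Y.
Proof.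
move=> [s [r rs]] H M a b sab; have [h bh] := extv0_lift r H sab.
by exists (h \oc s); rewrite compmA bh.
Qed.

Lemma extv0_dsum n (F : 'I_n -> E) S Y :
  is_dsum F S -> (forall i, extv 0 (F i) Y) -> extv 0 S Y.
Proof.
move=> [s [p [ps pns sp]]] H M a b sab.
have [h bh] := functional_choice (fun i (h : homset S M) => b \oc h = s i \oc p i)
  (fun i => let: ex_intro h bh := extv0_lift (s i) (H i) sab in
     ex_intro _ (h \oc p i) (etrans (compmA _ _ _) (congr1 (fun x => x \oc p i) bh))).
by exists (\sum_i h i); rewrite comp_sumr -sp; apply: eq_bigr => i _.
Qed.

End Ext1.

Section Ext1op.
Variables (k : fieldType) (E : linCat k).
Hypothesis abE : abelian_cat E.
Implicit Types X Y Z W : E.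
Let abO := abelian_op abE.

Lemma extv0_ext X Y L M (a : homset L M) (b : homset M X) (f : homset L Y) :
  extv 0 X Y -> ses a b -> exists h, h \oc a = f.
Proof.
move=> H sab; exact: (@extv0_lift _ (opcat E) abO Y X M L b a f (extv0_op H) (ses_op sab)).
Qed.

Lemma extv0_inj X Y I Y' (u : homset Y I) (p : homset I Y') :
  injective_ob I -> ses u p -> (forall f : homset X Y', exists h, p \oc h = f) ->
  extv 0 X Y.
Proof.
move=> iI sup H M a b sab; apply: (@extv0_op _ (opcat E) Y X _ M a b sab).
have pI : projective (E := opcat E) I by move=> V W g f; apply: iI.
exact: (@extv0_proj _ (opcat E) Y X Y' I p u pI (ses_op sup) H).
Qed.

(** Both sides express Ext^2(X, Y) = 0, computed from a syzygy of [X] or from a cosyzygy of [Y]. *)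
Lemma extv0_shift X Y K P I Y' (u : homset K P) (p : homset P X)
  (v : homset Y I) (q : homset I Y') :
  projective P -> ses u p -> injective_ob I -> ses v q ->
  extv 0 K Y <-> extv 0 X Y'.
Proof.
move=> pP sup iI svq; split=> H.
  apply: (extv0_proj pP sup) => f; have [g qg] := extv0_lift abE f H svq.
  have [h hu] := iI _ _ u g (ses_mono sup).
  by exists (q \oc h); rewrite -compmA hu.
apply: (extv0_inj iI svq) => f; have [g gu] := extv0_ext f H sup.
have [h qh] := pP _ _ q g (ses_epi svq).
by exists (h \oc u); rewrite compmA qh.
Qed.

End Ext1op.

(** * Consequences of the long exact Ext sequences *)

Section LongExact.
Variables (k : fieldType) (E : linCat k).
Hypotheses (abE : abelian_cat E) (EP : enough_projectives E) (EI : enough_injectives E).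
Implicit Types X Y Z W : E.

Lemma syzygy_ex X : exists K, syzygy X K.
Proof.
have [P [f [pP ef]]] := EP X; have [K [u su]] := epi_ses_ex abE ef.
by exists K, P, u, f.
Qed.

Lemma cosyzygy_ex X : exists K, cosyzygy X K.
Proof.
have [P [f [pP ef]]] := EI X; have [K [u su]] := mono_ses_ex abE ef.
by exists K, P, f, u.
Qed.

(** This trades the recursion on [X] in [extv] for one on [Y]. Inductions can then keep the first
    variable fixed, and syzygies of the terms of a short exact sequence never have to be
    compared. *)
Lemma extv_shift i X Y Y' : cosyzygy Y Y' -> extv i.+1 X Y <-> extv i X Y'.
Proof.
move=> cY; elim: i X => [|i IH] X; last first.
  by split=> H K sK; apply/IH; apply: H.
have [I [v [q [iI svq]]]] := cY; split=> [H | H K].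
  have [K sK] := syzygy_ex X; have [P [u [p [pP sup]]]] := sK.
  by apply/(extv0_shift abE pP sup iI svq); exact: H.
by move=> [P [u [p [pP sup]]]]; apply/(extv0_shift abE pP sup iI svq).
Qed.

(** [extv] quantifies over all syzygies; a single one suffices, as the condition on the cosyzygy of
    [Y] does not see the choice. *)
Lemma extv_syzygy i X Y K : syzygy X K -> extv i K Y -> extv i.+1 X Y.
Proof.
move=> sK; elim: i Y => [|i IH] Y H; have [Y' cY] := cosyzygy_ex Y; apply/(extv_shift _ _ cY).
  have [I [v [q [iI svq]]]] := cY; have [P [u [p [pP sup]]]] := sK.
  by apply/(extv0_shift abE pP sup iI svq).
by apply: IH; apply/(extv_shift _ _ cY).
Qed.

Lemma extv_retract i X Z Y : retract_of X Z -> extv i Z Y -> extv i X Y.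
Proof.
move=> rXZ; elim: i Y => [|i IH] Y; first exact: extv0_retract.
have [Y' cY] := cosyzygy_ex Y.
by move/(extv_shift _ _ cY) => H; apply/(extv_shift _ _ cY); apply: IH.
Qed.

Lemma projective_extv i P Y : projective P -> extv i P Y.
Proof.
move=> pP; elim: i Y => [|i IH] Y; first exact: projective_extv0.
by have [Y' cY] := cosyzygy_ex Y; apply/(extv_shift _ _ cY).
Qed.

Lemma extv_extension i X1 X X2 Y (f : homset X1 X) (g : homset X X2) :
  ses f g -> extv i X1 Y -> extv i X2 Y -> extv i X Y.
Proof.
move=> sfg; elim: i Y => [|i IH] Y; have [Y' cY] := cosyzygy_ex Y; last first.
  move/(extv_shift _ _ cY) => H1 /(extv_shift _ _ cY) => H2.
  by apply/(extv_shift _ _ cY); apply: IH.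
have [I [v [q [iI svq]]]] := cY; move=> H1 H2.
apply: (extv0_inj iI svq) => h.
(* To lift [h] through [q]: lift its restriction to [X1], extend this to [X] by injectivity of [I],
   and lift the remaining difference, which factors through [X2]. *)
have [h1 e1] := extv0_lift abE (h \oc f) H1 svq.
have [h2 e2] := iI _ _ f h1 (ses_mono sfg).
have [|h3 e3] := cokernelE (h := h - q \oc h2) sfg.2.
  by rewrite compBl -compmA e2 e1 subrr.
have [h4 e4] := extv0_lift abE h3 H2 svq.
by exists (h4 \oc g + h2); rewrite compDr compmA e4 e3 subrK.
Qed.

Lemma extv_kernel i X1 X X2 Y (f : homset X1 X) (g : homset X X2) :
  ses f g -> extv i X Y -> extv i.+1 X2 Y -> extv i X1 Y.
Proof.
move=> sfg; elim: i Y => [|i IH] Y; have [Y' cY] := cosyzygy_ex Y; last first.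
  move/(extv_shift _ _ cY) => H1 /(extv_shift _ _ cY) => H2.
  by apply/(extv_shift _ _ cY); apply: IH.
have [I [v [q [iI svq]]]] := cY; move=> H1 /(extv_shift _ _ cY) H2.
apply: (extv0_inj iI svq) => h.
have [h1 e1] := extv0_ext abE h H2 sfg.
have [h2 e2] := extv0_lift abE h1 H1 svq.
by exists (h2 \oc f); rewrite compmA e2 e1.
Qed.

Lemma extv_cokernelr i X Y1 Y Y2 (f : homset Y1 Y) (g : homset Y Y2) :
  ses f g -> extv i.+1 X Y1 -> extv i X Y -> extv i X Y2.
Proof.
move=> sfg; elim: i X => [|i IH] X H1 H; last first.
  by move=> K sK; apply: IH; [apply: H1 | apply: H].
have [K sK] := syzygy_ex X; have [P [u [p [pP sup]]]] := sK.
apply: (extv0_proj pP sup) => h.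
have [h1 e1] := extv0_lift abE h (H1 _ sK) sfg.
have [h2 e2] := extv0_ext abE h1 H sup.
by exists (g \oc h2); rewrite -compmA e2 e1.
Qed.

Lemma extv_extensionr i X Y1 Y Y2 (f : homset Y1 Y) (g : homset Y Y2) :
  ses f g -> extv i X Y1 -> extv i X Y2 -> extv i X Y.
Proof.
move=> sfg; elim: i X => [|i IH] X H1 H2; last first.
  by move=> K sK; apply: IH; [apply: H1 | apply: H2].
have [K sK] := syzygy_ex X; have [P [u [p [pP sup]]]] := sK.
apply: (extv0_proj pP sup) => h.
have [h1 e1] := extv0_ext abE (g \oc h) H2 sup.
have [h2 e2] := pP _ _ g h1 (ses_epi sfg).
have [|h3 e3] := kernelE (h := h - h2 \oc u) sfg.1.
  by rewrite compBr compmA e2 e1 subrr.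
have [h4 e4] := extv0_ext abE h3 H1 sup.
by exists (f \oc h4 + h2); rewrite compDl -compmA e4 e3 subrK.
Qed.

(** Vanishing for all second arguments applies in particular to cosyzygies, and passing to a
    cosyzygy shifts the degree by one. *)
Lemma extv_weaken n i X : (forall Y, extv n X Y) -> (n <= i)%N -> forall Y, extv i X Y.
Proof.
move=> H; elim: i => [|i IH]; first by rewrite leqn0 => /eqP <-.
rewrite leq_eqVlt => /orP[/eqP <- //|ni] Y.
by have [Y' cY] := cosyzygy_ex Y; apply/(extv_shift _ _ cY); apply: IH.
Qed.

End LongExact.

(** * Projective resolutions *)

Section Resolutions.
Variables (k : fieldType) (E : linCat k).
Hypothesis abE : abelian_cat E.
Implicit Types X Y Z W K : E.

Lemma exact_at_comp0 X Y Z (f : homset X Y) (g : homset Y Z) :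
  exact_at f g -> g \oc f = 0.
Proof. by case=> K [u [e [[gu _] _ ->]]]; rewrite compmA gu comp0l. Qed.

Lemma exact_at_monor X Y Z W (f : homset X Y) (g : homset Y Z) (u : homset Z W) :
  mono u -> exact_at f (u \oc g) <-> exact_at f g.
Proof.
move=> mu; split=> -[K [v [e [kv ee ->]]]]; exists K, v, e; split=> //; apply: kernelI.
- exact: kernel_mono kv.
- by apply: (mono_eq0 mu); rewrite compmA kv.1.
- by move=> V h gh; apply: (kernelE kv); rewrite -compmA gh comp0r.
- exact: kernel_mono kv.
- by rewrite -compmA kv.1 comp0r.
- by move=> V h; rewrite -compmA => /(mono_eq0 mu) gh; apply: (kernelE kv).
Qed.

Lemma exact_at_ext X Y Z W (f : homset X Y) (g : homset Y Z) (h : homset Y W) :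
  exact_at f g -> epi g -> h \oc f = 0 -> exists m, m \oc g = h.
Proof.
case=> K [u [e [ku ee ->]]] eg; rewrite compmA => /(epi_eq0 ee) hu.
exact: (cokernelE (epi_ses abE eg ku).2 hu).
Qed.

Section Splice.
Variables (X K P : E) (u : homset K P) (p : homset P X).
Hypotheses (pP : projective P) (sup : ses u p).
Variable Q : proj_resolution K.

Let ob i := match i with 0 => P | j.+1 => Q j end.
Let d i : homset (ob i.+1) (ob i) :=
  match i with 0 => u \oc pr_aug Q | j.+1 => pr_d Q j end.

Fact splice_proj i : projective (ob i).
Proof. by case: i => [//|i]; exact: pr_proj. Qed.

Fact splice_exact0 : exact_at (d 0) p.
Proof. by exists K, u, (pr_aug Q); split=> //; [case: sup | exact: pr_epi]. Qed.

Fact splice_exact i : exact_at (d i.+1) (d i).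
Proof.
case: i => [|i]; last exact: pr_exact.
by apply/(exact_at_monor _ _ (ses_mono sup)); exact: pr_exact0.
Qed.

Definition splice : proj_resolution X :=
  ProjResolution splice_proj (ses_epi sup) splice_exact0 splice_exact.

End Splice.

Section Tail.
Variables (X K : E) (P : proj_resolution X) (u : homset K (P 0%N)) (e : homset (P 1%N) K).
Hypotheses (ku : is_kernel (pr_aug P) u) (ee : epi e) (de : pr_d P 0 = u \oc e).

Fact tail_exact0 : exact_at (pr_d P 1) e.
Proof. by apply/(exact_at_monor _ _ (kernel_mono ku)); rewrite -de; exact: pr_exact. Qed.

Definition tail : proj_resolution K :=
  @ProjResolution _ _ K (fun i => P i.+1) (fun i => pr_d P i.+1) e
    (fun i => @pr_proj _ _ _ P i.+1) ee tail_exact0 (fun i => @pr_exact _ _ _ P i.+1).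

End Tail.

Lemma zero_resolution Z : is_zero Z ->
  exists Q : proj_resolution Z, forall i, is_zero (Q i).
Proof.
move=> zZ.
have pZ : projective Z.
  by move=> Y W g f _; exists 0; rewrite comp0r (proj1 (zZ W) f).
have eZ : epi (idmor Z) by move=> W g h; rewrite !comp_idr.
have exZ : exact_at (0 : homset Z Z) (idmor Z).
  exists Z, (idmor Z), (idmor Z); split=> //; last by case: (zZ Z).
  split; first by case: (zZ Z).
  move=> W g _; exists g; split; first by rewrite comp_idl.
  by move=> h; rewrite comp_idl.
have exZ0 : exact_at (0 : homset Z Z) (0 : homset Z Z).
  have e := proj1 (zZ Z) (idmor Z); by rewrite e in exZ.
by exists (@ProjResolution _ _ Z (fun=> Z) (fun=> 0) (idmor Z) (fun=> pZ) eZ exZ (fun=> exZ0)).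
Qed.

(** [ext_zero] counts from Ext^0 and [extv] from Ext^1, hence the shift. A cocycle in degree i+2 of
    [P] is one in degree i+1 of its tail, which resolves the first syzygy. *)
Lemma ext_zero_extv i X Y : extv i X Y -> ext_zero i.+1 X Y.
Proof.
elim: i X => [|i IH] X H P f cf; have [K [u [e [ku ee de]]]] := pr_exact0 P;
  have sup := epi_ses abE (@pr_epi _ _ _ P) ku; last first.
  apply: (IH K _ (tail ku ee de) f cf); apply: H.
  by exists (P 0%N), u, (pr_aug P); split=> //; exact: pr_proj.
have [f' ef] := exact_at_ext (tail_exact0 ku de) ee cf.
have [g gu] := extv0_ext abE f' H sup.
by exists g; rewrite de compmA gu ef.
Qed.

Hypotheses (EP : enough_projectives E) (EI : enough_injectives E).

(** One resolution decides the vanishing; with [ext_zero_extv] this makes it independent of the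
    resolution. *)
Lemma extv_resolution i X Y (P : proj_resolution X) :
  (forall f : homset (P i.+1) Y, cocycle f -> coboundary f) -> extv i X Y.
Proof.
elim: i X P => [|i IH] X P H; have [K [u [e [ku ee de]]]] := pr_exact0 P;
  have sup := epi_ses abE (@pr_epi _ _ _ P) ku; last first.
  apply: (extv_syzygy abE EP EI (K := K)); last exact: (IH K (tail ku ee de)).
  by exists (P 0%N), u, (pr_aug P); split=> //; exact: pr_proj.
apply: (extv0_proj (@pr_proj _ _ _ P 0%N) sup) => f.
have [|g eg] := H (f \oc e).
  by rewrite /cocycle -compmA (exact_at_comp0 (tail_exact0 ku de)) comp0r.
by exists g; apply: ee; rewrite -compmA -de.
Qed.

(** [ext_zero] quantifies over all resolutions and would be vacuous without one; iterated choice of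
    syzygies supplies it. *)
Lemma resolution_ex X : exists P : proj_resolution X, True.
Proof.
(* The syzygy data are packed into one sigma type so that a choice principle can turn mere existence
   into data usable in a recursion. *)
pose pres Y (t : {K : E & {P : E & (homset K P * homset P Y)%type}}) :=
  let: existT K (existT P (u, p)) := t in projective P /\ ses u p.
have pick Y : {t | @pres Y t}.
  apply: constructive_indefinite_description.
  have [K [P [u [p H]]]] := syzygy_ex abE EP Y.
  by exists (existT _ K (existT _ P (u, p))).
pose Om := fix Om i := match i with 0 => X | j.+1 => projT1 (sval (pick (Om j))) end.
pose ob i : E := projT1 (projT2 (sval (pick (Om i)))).
pose u i : homset (Om i.+1) (ob i) := (projT2 (projT2 (sval (pick (Om i))))).1.
pose p i : homset (ob i) (Om i) := (projT2 (projT2 (sval (pick (Om i))))).2.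
have H i : projective (ob i) /\ ses (u i) (p i).
  rewrite /ob /u /p /=; by case: (pick (Om i)) => -[K [P [v q]]] /=.
have ex0 i : exact_at (u i \oc p i.+1) (p i).
  exists (Om i.+1), (u i), (p i.+1); split=> //; first by case: (H i) => _ [].
  by have [_ s] := H i.+1; exact: ses_epi s.
have ex i : exact_at (u i.+1 \oc p i.+2) (u i \oc p i.+1).
  by have [_ s] := H i; apply/(exact_at_monor _ _ (ses_mono s)).
by exists (@ProjResolution _ _ X ob (fun i => u i \oc p i.+1) (p 0%N)
  (fun i => proj1 (H i)) (ses_epi (proj2 (H 0%N))) (ex0 0%N) ex).
Qed.

Lemma ext_zeroP i X Y : ext_zero i.+1 X Y <-> extv i X Y.
Proof.
split; last exact: ext_zero_extv.
by move=> H; have [P _] := resolution_ex X; apply: (@extv_resolution i X Y P); exact: H.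
Qed.

Lemma extv_pd X n : pd_le X n -> forall Y, extv n X Y.
Proof.
case=> P zP Y; apply: (@extv_resolution n X Y P) => f _; exists 0.
by rewrite (proj1 (zP n.+1 (ltnSn n) Y) f) comp0l.
Qed.

Lemma pd_extv X n : (forall Y, extv n X Y) -> pd_le X n.
Proof.
elim: n X => [|n IH] X H.
  (* For [n = 0] the object is projective and is resolved by itself followed by zeros. *)
  have pX := extv0_projective abE H.
  have [Z zZ] := zero_ex abE.
  have [Q zQ] := zero_resolution zZ.
  have s : ses (0 : homset Z X) (idmor X).
    apply: epi_ses => //; first by move=> W g h; rewrite !comp_idr.
    apply: kernelI; [|by rewrite comp0r|].
      by apply: mono0 => W g _; apply: (proj2 (zZ W)).
    by move=> W h; rewrite comp_idl => ->; exists 0; rewrite comp0l.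
  by exists (splice pX s Q); case=> [//|i] _; exact: zQ.
have [K sK] := syzygy_ex abE EP X.
have [|Q zQ] := IH K; first by move=> Y; apply: H.
have [P [u [p [pP s]]]] := sK.
by exists (splice pP s Q); case=> [//|i] /zQ.
Qed.

Lemma right_perpP (D : E -> Prop) X :
  right_perp D X <-> (forall Y, D Y -> forall i, extv i Y X).
Proof.
split=> H Y DY; first by move=> i; apply/ext_zeroP; apply: H.
by case=> [//|i] _; apply/ext_zeroP; apply: H.
Qed.

Lemma left_perp1P (D : E -> Prop) X :
  left_perp1 D X <-> (forall Y, D Y -> extv 0 X Y).
Proof. by split=> H Y DY; apply/ext_zeroP; apply: H. Qed.

End Resolutions.

(** * Functors and adjunctions *)

Section AdditiveFunctors.
Variables (k : fieldType) (A B : linCat k) (F : addFunctor A B).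

Lemma fmap0 (X Y : A) : fmap F (0 : homset X Y) = 0.
Proof. by apply: (addrI (fmap F 0)); rewrite -fmapD !addr0. Qed.

Lemma fmap_sum (X Y : A) (I : Type) (r : seq I) (f : I -> homset X Y) :
  fmap F (\sum_(i <- r) f i) = \sum_(i <- r) fmap F (f i).
Proof. by elim: r => [|i r IH]; rewrite ?big_nil ?fmap0 // !big_cons fmapD IH. Qed.

Lemma fmap_dsum n (f : 'I_n -> A) S : is_dsum f S -> is_dsum (fun i => F (f i)) (F S).
Proof.
case=> s [p [ps pns sp]]; exists (fun i => fmap F (s i)), (fun i => fmap F (p i)); split.
- by move=> i; rewrite -fmap_comp ps fmap_id.
- by move=> i j ij; rewrite -fmap_comp pns // fmap0.
by rewrite -fmap_id -sp fmap_sum; apply: eq_bigr => i _; rewrite fmap_comp.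
Qed.

Lemma fmap_dsum2 (X Y Z : A) : is_dsum2 X Y Z -> is_dsum2 (F X) (F Y) (F Z).
Proof.
case=> s1 [s2 [p1 [p2 [h1 h2 h3 h4 h5]]]].
exists (fmap F s1), (fmap F s2), (fmap F p1), (fmap F p2).
by split; rewrite -?fmap_comp ?h1 ?h2 ?h3 ?h4 ?fmap_id ?fmap0 // -fmapD h5 fmap_id.
Qed.

Lemma fmap_iso (X Y : A) (f : homset X Y) : is_iso f -> is_iso (fmap F f).
Proof.
by case=> g [e1 e2]; exists (fmap F g); rewrite -!fmap_comp e1 e2 !fmap_id.
Qed.

Lemma fmap_zero (X : A) : is_zero X -> is_zero (F X).
Proof. by move=> zX; apply: is_zeroP; rewrite -fmap_id (proj1 (zX X) (idmor X)) fmap0. Qed.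

Hypothesis abA : abelian_cat A.

Lemma exact_epi (X Y : A) (f : homset X Y) : exact_functor F -> epi f -> epi (fmap F f).
Proof.
by move=> exF /(epi_ses_ex abA) [K [u s]]; apply: ses_epi; exact: exF s.
Qed.

Lemma exact_mono (X Y : A) (f : homset X Y) : exact_functor F -> mono f -> mono (fmap F f).
Proof.
by move=> exF /(mono_ses_ex abA) [K [u s]]; apply: ses_mono; exact: exF s.
Qed.

End AdditiveFunctors.

Definition unit_counit (k : fieldType) (A B : linCat k) (F : addFunctor A B)
  (G : addFunctor B A) (eta : forall X, homset X (G (F X)))
  (eps : forall Y, homset (F (G Y)) Y) : Prop :=
  [/\ forall X X' (f : homset X X'), fmap G (fmap F f) \oc eta X = eta X' \oc f,
      forall Y Y' (g : homset Y Y'), eps Y' \oc fmap F (fmap G g) = g \oc eps Y,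
      forall X, eps (F X) \oc fmap F (eta X) = idmor (F X)
    & forall Y, fmap G (eps Y) \oc eta (G Y) = idmor (G Y)].

(** The unit is the transpose of an identity and the counit the map whose transpose is an identity;
    the latter is extracted by choice, [bijective] being a proposition. *)
Lemma adjoint_unit_counit (k : fieldType) (A B : linCat k) (F : addFunctor A B)
  (G : addFunctor B A) : adjoint F G -> exists eta eps, @unit_counit k A B F G eta eps.
Proof.
case=> phi [bij nat].
have inj X Y : injective (@phi X Y) by exact: bij_inj.
have pick Y : {e | phi (G Y) Y e = idmor (G Y)}.
  apply: constructive_indefinite_description.
  by have [psi _ c] := bij (G Y) Y; exists (psi (idmor (G Y))).
pose eta X : homset X (G (F X)) := phi X (F X) (idmor (F X)).
pose eps Y : homset (F (G Y)) Y := sval (pick Y).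
have pe Y : phi (G Y) Y (eps Y) = idmor (G Y) by rewrite /eps; case: (pick Y).
have natl X Y Y' (g : homset Y Y') h : phi X Y' (g \oc h) = fmap G g \oc phi X Y h.
  by have := nat _ _ _ _ (idmor X) g h; rewrite fmap_id !comp_idr.
have natr X X' Y (f : homset X' X) h : phi X' Y (h \oc fmap F f) = phi X Y h \oc f.
  by have := nat _ _ _ _ f (idmor Y) h; rewrite fmap_id !comp_idl.
exists eta, eps; split.
- by move=> X X' f; rewrite /eta -natl -natr comp_idl comp_idr.
- by move=> Y Y' g; apply: inj; rewrite natr natl !pe comp_idl comp_idr.
- by move=> X; apply: inj; rewrite natr pe comp_idl.
- by move=> Y; rewrite /eta -natl comp_idr pe.
Qed.

Section Adjunction.
Variables (k : fieldType) (A B : linCat k) (F : addFunctor A B) (G : addFunctor B A).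
Variables (eta : forall X, homset X (G (F X))) (eps : forall Y, homset (F (G Y)) Y).
Hypothesis uc : unit_counit eta eps.

Let eta_nat X X' (f : homset X X') : fmap G (fmap F f) \oc eta X = eta X' \oc f.
Proof. by case: uc. Qed.
Let eps_nat Y Y' (g : homset Y Y') : eps Y' \oc fmap F (fmap G g) = g \oc eps Y.
Proof. by case: uc. Qed.
Let tri1 X : eps (F X) \oc fmap F (eta X) = idmor (F X).
Proof. by case: uc. Qed.
Let tri2 Y : fmap G (eps Y) \oc eta (G Y) = idmor (G Y).
Proof. by case: uc. Qed.

Lemma transposeK X Y (x : homset X (G Y)) :
  fmap G (eps Y \oc fmap F x) \oc eta X = x.
Proof. by rewrite fmap_comp -compmA eta_nat compmA tri2 comp_idl. Qed.

Lemma transposeVK X Y (h : homset (F X) Y) :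
  eps Y \oc fmap F (fmap G h \oc eta X) = h.
Proof. by rewrite fmap_comp compmA eps_nat -compmA tri1 comp_idr. Qed.

Lemma radj_kernel (X Y Z : B) (f : homset X Y) (g : homset Y Z) :
  is_kernel g f -> is_kernel (fmap G g) (fmap G f).
Proof.
move=> kf; apply: kernelI.
- apply: mono0 => W x fx.
  rewrite -(transposeK x); suff -> : eps X \oc fmap F x = 0 by rewrite fmap0 comp0l.
  apply: (mono_eq0 (kernel_mono kf)).
  by rewrite compmA -eps_nat -compmA -fmap_comp fx fmap0 comp0r.
- by rewrite -fmap_comp kf.1 fmap0.
move=> W h gh; have [|m em] := kernelE (h := eps Y \oc fmap F h) kf.
  by rewrite compmA -eps_nat -compmA -fmap_comp gh fmap0 comp0r.
by exists (fmap G m \oc eta W); rewrite compmA -fmap_comp em transposeK.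
Qed.

Lemma ladj_cokernel (X Y Z : A) (f : homset X Y) (g : homset Y Z) :
  is_cokernel f g -> is_cokernel (fmap F f) (fmap F g).
Proof.
move=> kf; apply: cokernelI.
- apply: epi0 => W x fx.
  rewrite -(transposeVK x); suff -> : fmap G x \oc eta Z = 0 by rewrite fmap0 comp0r.
  apply: (epi_eq0 (cokernel_epi kf)).
  by rewrite -compmA -eta_nat compmA -fmap_comp fx fmap0 comp0l.
- by rewrite -fmap_comp kf.1 fmap0.
move=> W h gh; have [|m em] := cokernelE (h := fmap G h \oc eta Y) kf.
  by rewrite -compmA -eta_nat compmA -fmap_comp gh fmap0 comp0l.
by exists (eps W \oc fmap F m); rewrite -compmA -fmap_comp em transposeVK.
Qed.

Lemma ladj_projective P :
  (forall Y Z (g : homset Y Z), epi g -> epi (fmap G g)) -> projective P -> projective (F P).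
Proof.
move=> epG pP Y Z g f eg; have [h gh] := pP _ _ _ (fmap G f \oc eta P) (epG _ _ _ eg).
exists (eps Y \oc fmap F h).
by rewrite compmA -eps_nat -compmA -fmap_comp gh transposeVK.
Qed.

Lemma radj_injective I :
  (forall Y Z (g : homset Y Z), mono g -> mono (fmap F g)) ->
  injective_ob I -> injective_ob (G I).
Proof.
move=> mF iI Y Z g f mg; have [h gh] := iI _ _ _ (eps I \oc fmap F f) (mF _ _ _ mg).
exists (fmap G h \oc eta Z).
by rewrite -compmA -eta_nat compmA -fmap_comp gh transposeK.
Qed.

(** The inverse is the preimage under [F] of the counit at [F X]. *)
Lemma ladj_full_unit_iso X : fully_faithful F -> is_iso (eta X).
Proof.
move=> ffF; have inj Y Z : injective (@fmap k A B F Y Z) by exact: bij_inj.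
have [r er] : exists r, fmap F r = eps (F X).
  by have [psi _ c] := ffF (G (F X)) X; exists (psi (eps (F X))).
exists r; split; first by apply: inj; rewrite fmap_comp er tri1 fmap_id.
rewrite -[LHS]transposeK (fmap_comp F) compmA tri1 comp_idl er.
exact: tri2.
Qed.

Lemma radj_full_counit_iso Y : fully_faithful G -> is_iso (eps Y).
Proof.
move=> ffG; have inj X Z : injective (@fmap k B A G X Z) by exact: bij_inj.
have [r er] : exists r, fmap G r = eta (G Y).
  by have [psi _ c] := ffG Y (F (G Y)); exists (psi (eta (G Y))).
exists r; split; last by apply: inj; rewrite fmap_comp er tri2 fmap_id.
rewrite -[LHS]transposeVK (fmap_comp G) -compmA tri2 comp_idr er.
exact: tri1.
Qed.

Hypotheses (abA : abelian_cat A) (abB : abelian_cat B).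

Lemma extv0_ladj X Y : exact_functor G -> extv 0 X (G Y) -> extv 0 (F X) Y.
Proof.
move=> exG H M a b sab; have [h bh] := extv0_lift abA (eta X) H (exG _ _ _ _ _ sab).
exists (eps M \oc fmap F h).
by rewrite compmA -eps_nat -compmA -fmap_comp bh tri1.
Qed.

Lemma extv0_radj X Y : exact_functor F -> extv 0 (F X) Y -> extv 0 X (G Y).
Proof.
move=> exF H M a b sab; have [h ha] := extv0_ext abB (eps Y) H (exF _ _ _ _ _ sab).
apply: (retraction_section (r := fmap G h \oc eta M) sab).
by rewrite -compmA -eta_nat compmA -fmap_comp ha tri2.
Qed.

(** [F] preserves projectives because [G] is exact, and is exact itself, so it maps syzygies to
    syzygies. This reduces everything to Ext^1, where splittings are transposed along the
    adjunction. *)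
Lemma extv_adj i X Y :
  enough_projectives A -> enough_projectives B -> enough_injectives B ->
  exact_functor F -> exact_functor G ->
  extv i (F X) Y <-> extv i X (G Y).
Proof.
move=> EPA EPB EIB exF exG; elim: i X => [|i IH] X.
  by split; [exact: extv0_radj | exact: extv0_ladj].
have Fsyz K : syzygy X K -> syzygy (F X) (F K).
  move=> [P [u [p [pP s]]]]; exists (F P), (fmap F u), (fmap F p); split; last exact: exF.
  by apply: ladj_projective => // V W g; apply: exact_epi.
split=> H; last first.
  have [K sK] := syzygy_ex abA EPA X.
  by apply: (extv_syzygy abB EPB EIB (Fsyz _ sK)); apply/IH; apply: H.
by move=> K sK; apply/IH; apply: H; apply: Fsyz.
Qed.

(** Push [fmap F v] out along the counit at [X]. The functor [G] inverts this counit, hence by the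
    five lemma also the map from [F V] to the pushout [X'], and so [G X'] is isomorphic to
    [G (F V)], that is to [V]. *)
Lemma glue_preenvelope X V U (v : homset (G X) V) (t : homset V U) :
  exact_functor F -> exact_functor G -> fully_faithful F -> ses v t ->
  exists X' (c : homset X X') (p : homset X' (F U)), ses c p /\ iso_ob V (G X').
Proof.
move=> exF exG ffF s.
have [X' [c [p [b [scp e1 e2 _]]]]] := pushout_ses abB (eps X) (exF _ _ _ _ _ s).
exists X', c, p; split=> //.
(* By a triangle identity this is a left inverse of the unit at [G X], which is invertible since [F]
   is fully faithful. *)
have isoGeps : is_iso (fmap G (eps X)).
  have [r [h1 h2]] := ladj_full_unit_iso (G X) ffF.
  exists (eta (G X)); split; last exact: tri2.
  have := congr1 (fun x => x \oc r) (tri2 X).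
  by rewrite -compmA h2 comp_idr comp_idl => ->.
have [b' [hb1 hb2]] : is_iso (fmap G b).
  apply: (five_iso abA (exG _ _ _ _ _ (exF _ _ _ _ _ s)) (exG _ _ _ _ _ scp)
            (a := fmap G (eps X)) (c := idmor _)) => //.
  - by rewrite -!fmap_comp e1.
  - by rewrite -fmap_comp e2 comp_idl.
  by exists (idmor _); rewrite !comp_idl.
have [r [h1 h2]] := ladj_full_unit_iso V ffF.
exists (fmap G b \oc eta V), (r \oc b'); split.
  by rewrite !compmA (comp_eq hb1) comp_idr.
by rewrite !compmA (comp_eq h2) comp_idr.
Qed.

End Adjunction.

(** * Cotorsion pairs and tilting *)

Section AddClosure.
Variables (k : fieldType) (E : linCat k).
Hypothesis abE : abelian_cat E.
Implicit Types X Y Z T : E.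

(** The maps factoring through a finite direct sum of copies of [T], with lists of components in
    place of an actual direct sum. *)
Definition factors_through T X Y (f : homset X Y) :=
  exists s : seq (homset X T * homset T Y), f = \sum_(t <- s) t.2 \oc t.1.

Lemma factors_throughD T X Y (f g : homset X Y) :
  factors_through T f -> factors_through T g -> factors_through T (f + g).
Proof. by move=> [s ->] [t ->]; exists (s ++ t); rewrite big_cat. Qed.

Lemma factors_through_sum T X Y (I : Type) (r : seq I) (f : I -> homset X Y) :
  (forall i, factors_through T (f i)) -> factors_through T (\sum_(i <- r) f i).
Proof.
move=> H; elim: r => [|i r IH]; first by exists [::]; rewrite !big_nil.
by rewrite big_cons; apply: factors_throughD.
Qed.

Lemma factors_throughI T X Y (a : homset X T) (b : homset T Y) : factors_through T (b \oc a).
Proof. by exists [:: (a, b)]; rewrite big_seq1. Qed.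

(** Membership in [add T] becomes a statement about one morphism that is stable under sums, so no
    direct sum has to be assembled by hand later. *)
Lemma add_closureP T X : add_closure T X <-> factors_through T (idmor X).
Proof.
split=> [[n [S [[s [p [_ _ sp]]] /summand_retract [i [r ri]]]]] | [s es]].
  rewrite -ri -[r]comp_idr -sp comp_sumr comp_suml.
  by apply: factors_through_sum => j; rewrite compmA -compmA; apply: factors_throughI.
have [dsum _ _ _ _] := abE.
have [S [i [p [pi pni ip]]]] := dsum (size s) (fun=> T); exists (size s), S.
split; first by exists i, p.
apply: (retract_summand abE).
pose t j := tnth (in_tuple s) j.
(* The listed pairs are the components of the inclusion and of the retraction. *)
exists (\sum_j i j \oc (t j).1), (\sum_j (t j).2 \oc p j).
rewrite comp_suml es [RHS]big_tnth; apply: eq_bigr => j _.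
rewrite comp_sumr (bigD1 j) //= big1 ?addr0 => [|l jl].
  by rewrite !compmA (comp_eq (pi j)) comp_idr.
by rewrite !compmA (comp_eq (pni j l _)) 1?eq_sym // comp0r comp0l.
Qed.

Lemma add_closure_self T : add_closure T T.
Proof. by apply/add_closureP; rewrite -[idmor T]comp_idl; apply: factors_throughI. Qed.

Lemma add_closure_min T (D : E -> Prop) X : is_subcat D -> D T -> add_closure T X -> D X.
Proof. by case=> _ ds sm DT [n [S [dS /sm]]]; apply; apply: ds dS. Qed.

Lemma subcat_retract (D : E -> Prop) X Y : is_subcat D -> retract_of X Y -> D Y -> D X.
Proof. by case=> _ _ H /(retract_summand abE); apply: H. Qed.

Lemma subcat_iso (D : E -> Prop) X Y : is_subcat D -> iso_ob X Y -> D X -> D Y.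
Proof. by case=> H _ _; apply: H. Qed.

Lemma subcat_zero (D : E -> Prop) Z : is_subcat D -> is_zero Z -> D Z.
Proof.
case=> _ ds _ zZ; have zero W : homset Z W * homset W Z by split; exact: 0.
apply: (ds 0%N (fun=> Z)); first by case.
exists (fun=> idmor Z), (fun=> idmor Z); split=> [[]//|[]//|].
by rewrite big_ord0 (proj1 (zZ Z) (idmor Z)).
Qed.

Lemma subcat_dsum2 (D : E -> Prop) X Y Z :
  is_subcat D -> is_dsum2 X Y Z -> D X -> D Y -> D Z.
Proof.
move=> sD [s1 [s2 [p1 [p2 [h1 h2 h3 h4 h5]]]]] DX DY.
pose F (i : 'I_2) : E := if val i is 0 then X else Y.
pose s (i : 'I_2) : homset (F i) Z :=
  match val i as v return homset (if v is 0 then X else Y) Z with 0 => s1 | _ => s2 end.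
pose p (i : 'I_2) : homset Z (F i) :=
  match val i as v return homset Z (if v is 0 then X else Y) with 0 => p1 | _ => p2 end.
case: sD => _ ds _; apply: (ds 2%N F); first by case=> -[|m] lm.
exists s, p; split.
- by case=> -[|m].
- by case=> [[|[|m]] lm] [[|[|m']] lm'].
by rewrite !big_ord_recl big_ord0 addr0 h5.
Qed.

End AddClosure.

(** * Cotorsion pairs and a criterion for being tilting *)

Section Tilting.
Variables (k : fieldType) (E : linCat k).
Hypotheses (abE : abelian_cat E) (EP : enough_projectives E) (EI : enough_injectives E).
Implicit Types (X Y Z : E) (D U V : E -> Prop).

(** Along a finite coresolution by [D], Ext^i of the kernel is squeezed between Ext^i of the middle
    term and Ext^(i+1) of the cokernel; a condition on all degrees above a threshold therefore
    propagates. *)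
Lemma vee_extv D m Y :
  (forall T, D T -> forall i, (m <= i)%N -> extv i T Y) ->
  forall X, vee D X -> forall i, (m <= i)%N -> extv i X Y.
Proof.
move=> H X [n]; elim: n X => [|n IH] X; first exact: H.
case=> [Z [C [f [g [DZ vC s]]]]] i mi.
by apply: (extv_kernel abE EP EI s); [exact: H | apply: IH => //; exact: leqW].
Qed.

Lemma is_subcat_eq D D' : subcat_eq D D' -> is_subcat D -> is_subcat D'.
Proof.
move=> e [h1 h2 h3]; split.
- by move=> X Y /h1 H /e DX; apply/e; apply: H.
- by move=> n F S H dS; apply/e; apply: (h2 n F) => // i; apply/e.
- by move=> X Y /h3 H /e DY; apply/e; apply: H.
Qed.

Lemma n_tilting_eq n D D' : subcat_eq D D' -> n_tilting n D -> n_tilting n D'.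
Proof.
move=> e [n0 sD p1 p2 p3]; split=> //; first exact: is_subcat_eq sD.
- by move=> X /e; apply: p1.
- by move=> X Y /e DX /e DY; apply: p2.
move=> P /p3 [R [T [R0 DT sR DR]]]; exists R, T; split=> //; last exact/e.
by move=> i /DT /e.
Qed.

Lemma is_subcat_cap D D' : is_subcat D -> is_subcat D' -> is_subcat (subcat_cap D D').
Proof.
move=> [h1 h2 h3] [h1' h2' h3']; split.
- by move=> X Y iXY [DX DX']; split; [exact: h1 DX | exact: h1' DX'].
- move=> n F S H dS; split; [apply: h2 dS | apply: h2' dS] => i; by case: (H i).
- by move=> X Y iXY [DX DX']; split; [exact: h3 DX | exact: h3' DX'].
Qed.

Lemma vee_n_chain D n X : vee_n D n X ->
  exists R T : nat -> E,
    [/\ R 0%N = X, forall i, (i < n)%N -> D (T i),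
        forall i, (i < n)%N -> exists (f : homset (R i) (T i)) (g : homset (T i) (R i.+1)),
          ses f g
      & D (R n)].
Proof.
elim: n X => [|n IH] X /=; first by exists (fun=> X), (fun=> X).
case=> [Z [C [f [g [DZ /IH [R [T [R0 DT sR DR]]] s]]]]].
exists (fun i => if i is j.+1 then R j else X), (fun i => if i is j.+1 then T j else Z).
split=> //; first by case=> // i /DT.
case=> [_|i]; last exact: sR.
by move: g s; rewrite -R0 => g s; exists f, g.
Qed.

Section CotorsionPair.
Variables U V : E -> Prop.
Hypothesis cUV : cotorsion_pair U V.

(** The special precover of [X] splits, its kernel lying in [V]. *)
Lemma cotorsion_left X : (forall Y, V Y -> extv 0 X Y) -> U X.
Proof.
case: cUV => sU sV _ pc _ H; have [V' [U' [f [g [VV UU s]]]]] := pc X.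
have [h gh] := H _ VV _ _ _ s.
by apply: (subcat_retract abE sU _ UU); exists h, g.
Qed.

Lemma cotorsion_right X : (forall Y, U Y -> extv 0 Y X) -> V X.
Proof.
case: cUV => sU sV _ _ pc H; have [V' [U' [f [g [VV UU s]]]]] := pc X.
have [h gh] := H _ UU _ _ _ s.
have [r rf] := section_retraction s gh.
by apply: (subcat_retract abE sV _ VV); exists f, r.
Qed.

Lemma cotorsion_extv0 X Y : U X -> V Y -> extv 0 X Y.
Proof. by case: cUV => _ _ H _ _ UX VY; apply/(ext_zeroP abE EP EI); apply: H. Qed.

Lemma cotorsion_left_extension X1 X X2 (f : homset X1 X) (g : homset X X2) :
  ses f g -> U X1 -> U X2 -> U X.
Proof.
move=> s U1 U2; apply: cotorsion_left => Y VY.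
by apply: (extv_extension abE EP EI s); apply: cotorsion_extv0.
Qed.

Lemma cotorsion_right_extension X1 X X2 (f : homset X1 X) (g : homset X X2) :
  ses f g -> V X1 -> V X2 -> V X.
Proof.
move=> s V1 V2; apply: cotorsion_right => Y UY.
by apply: (extv_extensionr abE EP s); apply: cotorsion_extv0.
Qed.

(* Coresolve by special preenvelopes; the m-th cosyzygy lies in [V] because
   Ext^1(U, -) of it is Ext^(m+1)(U, X). *)
Lemma cotorsion_coresolution m X :
  (forall Z Y i, U Z -> V Y -> extv i Z Y) ->
  U X -> (forall Z, U Z -> extv m Z X) -> vee_n (subcat_cap U V) m X.
Proof.
move=> H; elim: m X => [|m IH] X UX extX; first by split=> //; apply: cotorsion_right.
case: cUV => _ _ _ _ /(_ X) [V' [U' [f [g [VV UU s]]]]].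
have UV' : U V' by apply: cotorsion_left_extension s UX UU.
exists V', U', f, g; split=> //; apply: IH => // Z UZ.
by apply: (extv_cokernelr abE EP s); [exact: extX | exact: H].
Qed.

(** The bound [m] controls two things at once: the projective dimension of [U], and the length of
    the coresolutions of objects of [U] by the kernel of the pair. Projectives lie in [U], which
    gives the last tilting axiom. *)
Lemma bounded_tilting m :
  (0 < m)%N -> (forall X Y i, U X -> V Y -> extv i X Y) ->
  (forall X Y, U X -> extv m X Y) ->
  (forall X, right_perp (subcat_cap U V) X -> V X) ->
  tilting_cotorsion_pair U V /\ n_tilting m (subcat_cap U V).
Proof.
move=> m0 H bd perp.
have veeU X : U X -> vee_n (subcat_cap U V) m X.
  by move=> UX; apply: cotorsion_coresolution => // Z UZ; apply: bd.
have nt : n_tilting m (subcat_cap U V).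
  split=> //.
  - by case: cUV => sU sV _ _ _; apply: is_subcat_cap.
  - by move=> X [UX _]; apply: (pd_extv abE EP) => Y; apply: bd.
  - move=> X Y [UX _] [_ VY] [//|i] _; apply/(ext_zeroP abE EP EI); exact: H.
  move=> P pP; apply: vee_n_chain; apply: veeU; apply: cotorsion_left => Y _.
  exact: projective_extv0.
split=> //; split=> //; last first.
- move=> X; split=> [VX|]; last exact: perp.
  by apply/(right_perpP abE EP EI) => Y [UY _] i; apply: H.
- move=> X; split=> [/veeU vX|vX]; first by exists m.
  apply: cotorsion_left => Y VY; apply: (vee_extv (m := 0%N) (Y := Y) _ vX) => //.
  by move=> T [UT _] i _; apply: H.
- by exists m.
by move=> X Y UX VY; apply/(ext_zeroP abE EP EI); apply: H.
Qed.

End CotorsionPair.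

Section TiltingPair.
Variables U V : E -> Prop.
Hypothesis tUV : tilting_cotorsion_pair U V.

Lemma tilting_extv X Y i : U X -> V Y -> extv i X Y.
Proof.
case: tUV => _ _ _ eU eV /eU vX /eV /(right_perpP abE EP EI) H.
by apply: (vee_extv (m := 0%N) (Y := Y) _ vX) => // T capT j _; apply: H.
Qed.

(** The bound on the projective dimension of the tilting subcategory passes to [U] along
    coresolutions. *)
Lemma tilting_bound : exists m, (0 < m)%N /\ forall i X Y, (m <= i)%N -> U X -> extv i X Y.
Proof.
case: tUV => _ _ [m [m0 _ pd _ _]] eU _; exists m; split=> // i X Y mi /eU vX.
apply: (vee_extv (m := m) (Y := Y) _ vX) => // T /pd pT j mj.
by apply: (extv_weaken abE EP EI _ mj); apply: (extv_pd abE EP EI).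
Qed.

Lemma tilting_rightP X :
  V X <-> forall T, subcat_cap U V T -> forall i, extv i T X.
Proof.
case: tUV => _ _ _ _ eV; split; first by move/eV/(right_perpP abE EP EI).
by move=> H; apply/eV; apply/(right_perpP abE EP EI).
Qed.

End TiltingPair.

End Tilting.

(** * Recollements *)

Section SesComplements.
Variables (k : fieldType) (E : linCat k).
Hypothesis abE : abelian_cat E.
Implicit Types X Y Z : E.

Lemma iso_obC X Y : iso_ob X Y -> iso_ob Y X.
Proof. by case=> f [g [e1 e2]]; exists g, f. Qed.

Lemma is_iso_ob X Y (f : homset X Y) : is_iso f -> iso_ob X Y.
Proof. by exists f. Qed.

Lemma zero_iso X Y : iso_ob X Y -> is_zero X -> is_zero Y.
Proof.
case=> f [g [_ e]] zX; apply: is_zeroP.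
by rewrite -e (proj1 (zX Y) f) comp0l.
Qed.

Lemma epi_zero X Y (f : homset X Y) : epi f -> f = 0 -> is_zero Y.
Proof. by move=> ef f0; apply: is_zeroP; apply: (epi_eq0 ef); rewrite comp_idl. Qed.

Lemma ses_zero_iso X Y Z (f : homset X Y) (g : homset Y Z) :
  ses f g -> is_zero Z -> is_iso f.
Proof.
move=> s zZ; apply: mono_epi_iso => //; first exact: ses_mono s.
apply: epi0 => W h /(cokernelE s.2) [m <-].
by rewrite (proj1 (zZ W) m) comp0l.
Qed.

(** The pushout of two monos out of [K] sits in both a row and a column. With [P] projective and
    [V], [W] from a special preenvelope of [K], the column is a special precover of [X]. *)
Lemma pushout_ses2 K P X V W (u : homset K P) (p : homset P X)
  (f : homset K V) (g : homset V W) :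
  ses u p -> ses f g ->
  exists Z (c : homset P Z) (q : homset Z W) (b : homset V Z) (h : homset Z X),
    ses c q /\ ses b h.
Proof.
move=> su sf; have [Z [c [q [b [sc e1 e2 H]]]]] := pushout_ses abE u sf.
have [|h [h1 h2]] := H _ p (0 : homset V X); first by rewrite (ses0 su) comp0l.
exists Z, c, q, b, h; split=> //; apply: mono_ses => //.
  apply: mono0 => Y x bx.
  have [|y ey] := kernelE (h := x) sf.1; first by rewrite -e2 -compmA bx comp0r.
  suff -> : x = 0 by [].
  rewrite -ey; suff -> : y = 0 by rewrite comp0r.
  apply: (mono_eq0 (mono_comp (ses_mono sc) (ses_mono su))).
  by rewrite -e1 -compmA ey.
apply: cokernelI => //.
  by apply: (@epi_compl _ _ _ _ _ _ c); rewrite h1; exact: ses_epi su.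
move=> Y m mb; have [|n en] := cokernelE (h := m \oc c) su.2.
  by rewrite -compmA -e1 compmA mb comp0l.
exists n; apply/eqP; rewrite eq_sym -subr_eq0; apply/eqP.
have [|l el] := cokernelE (h := m - n \oc h) sc.2.
  by rewrite compBl -(compmA n) h1 en subrr.
rewrite -el; suff -> : l = 0 by rewrite comp0l.
apply: (epi_eq0 (ses_epi sf)).
by rewrite -e2 compmA el compBl mb -compmA h2 comp0r subrr.
Qed.

End SesComplements.

(** As a right adjoint [G] preserves kernels, as a left adjoint cokernels. *)
Lemma biadjoint_exact (k : fieldType) (A B : linCat k) (F H : addFunctor A B)
  (G : addFunctor B A) : adjoint F G -> adjoint G H -> exact_functor G.
Proof.
move=> /adjoint_unit_counit [eta [eps uc]] /adjoint_unit_counit [eta' [eps' uc']].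
by move=> X Y Z f g [kf cg]; split; [exact: (radj_kernel uc) | exact: (ladj_cokernel uc')].
Qed.

Section Recollement.
Variables (k : fieldType) (A B C : linCat k).
Hypotheses (abA : abelian_cat A) (abB : abelian_cat B) (abC : abelian_cat C).
Variable R : recollement A B C.
Hypotheses (EPB : enough_projectives B) (EIB : enough_injectives B).
Hypotheses (exi : exact_functor (i_upshriek R)) (exj : exact_functor (j_lowshriek R)).

Lemma i_lowstar_exact : exact_functor (i_lowstar R).
Proof. exact: biadjoint_exact (i_adj1 R) (i_adj2 R). Qed.

Lemma j_upstar_exact : exact_functor (j_upstar R).
Proof. exact: biadjoint_exact (j_adj1 R) (j_adj2 R). Qed.

Lemma j_upstar_i_lowstar X : is_zero (j_upstar R (i_lowstar R X)).
Proof.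
apply/(im_i_ker_j R); exists X, (idmor _), (idmor _).
by rewrite comp_idl.
Qed.

(** Transposing the identity of i^! j_* X through both adjunctions gives a map out of an object of
    the form j^* i_* W, which is zero. *)
Lemma i_upshriek_j_lowstar X : is_zero (i_upshriek R (j_lowstar R X)).
Proof.
have [eta [eps uc]] := adjoint_unit_counit (i_adj2 R).
have [eta' [eps' uc']] := adjoint_unit_counit (j_adj2 R).
apply: is_zeroP; rewrite -[LHS](transposeK uc).
set h := eps _ \oc _; rewrite -[h](transposeK uc').
by rewrite (proj1 (j_upstar_i_lowstar _ _) (eps' X \oc _)) fmap0 comp0l fmap0 comp0l.
Qed.

Lemma i_lowstar_unit X : exists eta : homset X (i_upshriek R (i_lowstar R X)),
  is_iso eta /\
  forall Y (t : homset X (i_upshriek R Y)), exists h, fmap (i_upshriek R) h \oc eta = t.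
Proof.
have [eta [eps uc]] := adjoint_unit_counit (i_adj2 R); exists (eta X); split.
  exact: (ladj_full_unit_iso uc _ (i_lowstar_ff R)).
by move=> Y t; exists (eps Y \oc fmap _ t); apply: (transposeK uc).
Qed.

Lemma j_lowshriek_unit X : exists eta : homset X (j_upstar R (j_lowshriek R X)),
  is_iso eta /\
  forall Y (t : homset X (j_upstar R Y)), exists h, fmap (j_upstar R) h \oc eta = t.
Proof.
have [eta [eps uc]] := adjoint_unit_counit (j_adj1 R); exists (eta X); split.
  exact: (ladj_full_unit_iso uc _ (j_lowshriek_ff R)).
by move=> Y t; exists (eps Y \oc fmap _ t); apply: (transposeK uc).
Qed.

Lemma j_lowstar_counit X : iso_ob (j_upstar R (j_lowstar R X)) X.
Proof.
have [eta [eps uc]] := adjoint_unit_counit (j_adj2 R); exists (eps X).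
exact: (radj_full_counit_iso uc _ (j_lowstar_ff R)).
Qed.

(** Let [Q] be the cokernel. From j^* Q = 0 it follows that [Q] is some i_* W, and then W is
    isomorphic to i^! Q, which vanishes as well. *)
Lemma recollement_epi (X Y : B) (f : homset X Y) :
  epi (fmap (i_upshriek R) f) -> epi (fmap (j_upstar R) f) -> epi f.
Proof.
move=> ei ej; have [Q [q cq]] := cokernel_ex abB f; have eq := cokernel_epi cq.
have zj : is_zero (j_upstar R Q).
  apply: (epi_zero (exact_epi abB j_upstar_exact eq)).
  by apply: (epi_eq0 ej); rewrite -fmap_comp cq.1 fmap0.
have zi : is_zero (i_upshriek R Q).
  apply: (epi_zero (exact_epi abB exi eq)).
  by apply: (epi_eq0 ei); rewrite -fmap_comp cq.1 fmap0.
have /(im_i_ker_j R) [W iW] := zj.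
have zQ : is_zero Q.
  apply: (zero_iso iW); apply: fmap_zero; have [eta [isoeta _]] := i_lowstar_unit W.
  apply: (zero_iso (iso_obC (is_iso_ob isoeta))).
  case: iW => g isog; apply: (zero_iso _ zi).
  exact: iso_obC (is_iso_ob (fmap_iso _ isog)).
apply: epi0 => V h /(cokernelE cq) [m <-].
by rewrite (proj1 (zQ V) m) comp0l.
Qed.

(** Epis are detected by i^! and j^* jointly: i^! j_* is zero and j^* j_* is the identity up to
    isomorphism. *)
Lemma j_lowstar_epi (X Y : C) (f : homset X Y) : epi f -> epi (fmap (j_lowstar R) f).
Proof.
move=> ef; apply: recollement_epi.
  by apply: epi0 => V h _; apply: (proj1 (i_upshriek_j_lowstar Y V)).
have [eta [eps uc]] := adjoint_unit_counit (j_adj2 R).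
have [_ nat _ _] := uc.
have [r [h1 h2]] := radj_full_counit_iso uc X (j_lowstar_ff R).
have [r' [h1' h2']] := radj_full_counit_iso uc Y (j_lowstar_ff R).
have -> : fmap (j_upstar R) (fmap (j_lowstar R) f) = r' \oc (f \oc eps X).
  by rewrite -nat compmA h1' comp_idl.
apply: epi_comp; first by apply: epi_section h1'.
by apply: epi_comp => //; apply: epi_section h2.
Qed.

Lemma j_lowstar_exact : exact_functor (j_lowstar R).
Proof.
have [eta [eps uc]] := adjoint_unit_counit (j_adj2 R).
move=> X Y Z f g s; apply: epi_ses => //; first by apply: j_lowstar_epi; exact: ses_epi s.
exact: (radj_kernel uc s.1).
Qed.

(** i^* is left adjoint to the exact i_*, so it preserves projectives and epis; apply it to a
    projective cover of i_* X. *)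
Lemma enough_projectivesA : enough_projectives A.
Proof.
move=> X; have [P [f [pP ef]]] := EPB (i_lowstar R X).
have [eta [eps uc]] := adjoint_unit_counit (i_adj1 R).
exists (i_upstar R P), (eps X \oc fmap (i_upstar R) f); split.
  apply: (ladj_projective uc) pP => Y Z g; exact: (exact_epi abA i_lowstar_exact).
have [r [h1 h2]] := radj_full_counit_iso uc X (i_lowstar_ff R).
apply: epi_comp; first exact: epi_section h2.
have [K [u s]] := epi_ses_ex abB ef; exact: cokernel_epi (ladj_cokernel uc s.2).
Qed.

(** j^* preserves projectives, being left adjoint to the exact j_*; apply it to an epi from a
    projective onto j_! X. *)
Lemma enough_projectivesC : enough_projectives C.
Proof.
move=> X; have [P [f [pP ef]]] := EPB (j_lowshriek R X).
have [eta [eps uc]] := adjoint_unit_counit (j_adj2 R).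
have [eta' [[r [h1 h2]] _]] := j_lowshriek_unit X.
exists (j_upstar R P), (r \oc fmap (j_upstar R) f); split.
  by apply: (ladj_projective uc) pP => Y Z g; exact: j_lowstar_epi.
by apply: epi_comp; [exact: epi_section h1 | exact: (exact_epi abB j_upstar_exact ef)].
Qed.

Lemma enough_injectivesA : enough_injectives A.
Proof.
move=> X; have [I [f [iI mf]]] := EIB (i_lowstar R X).
have [eta [eps uc]] := adjoint_unit_counit (i_adj2 R).
have [eta' [[r [h1 h2]] _]] := i_lowstar_unit X.
exists (i_upshriek R I), (fmap (i_upshriek R) f \oc eta'); split.
  apply: (radj_injective uc) iI => Y Z g; exact: (exact_mono abA i_lowstar_exact).
by apply: mono_comp; [exact: exact_mono exi mf | exact: mono_retract h1].
Qed.

Lemma enough_injectivesC : enough_injectives C.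
Proof.
move=> X; have [I [f [iI mf]]] := EIB (j_lowstar R X).
have [eta [eps uc]] := adjoint_unit_counit (j_adj1 R).
have [e [r [h1 h2]]] := j_lowstar_counit X.
exists (j_upstar R I), (fmap (j_upstar R) f \oc r); split.
  by apply: (radj_injective uc) iI => Y Z g; exact: (exact_mono abC exj).
by apply: mono_comp; [exact: exact_mono j_upstar_exact mf | exact: mono_retract h2].
Qed.

Lemma extv_i_lowstar i X Y :
  extv i (i_lowstar R X) Y <-> extv i X (i_upshriek R Y).
Proof.
have [eta [eps uc]] := adjoint_unit_counit (i_adj2 R).
by apply: (extv_adj uc) => //; [exact: enough_projectivesA | exact: i_lowstar_exact].
Qed.

Lemma extv_j_lowshriek i X Y :
  extv i (j_lowshriek R X) Y <-> extv i X (j_upstar R Y).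
Proof.
have [eta [eps uc]] := adjoint_unit_counit (j_adj1 R).
by apply: (extv_adj uc) => //; [exact: enough_projectivesC | exact: j_upstar_exact].
Qed.

Lemma extv0_j_upstar X Y : extv 0 X (j_lowstar R Y) -> extv 0 (j_upstar R X) Y.
Proof.
have [eta [eps uc]] := adjoint_unit_counit (j_adj2 R).
by apply: (extv0_ladj uc abB); exact: j_lowstar_exact.
Qed.

(** The cokernel lies in the image of i_*, so j^* does not notice the passage from [X] to [X']. *)
Lemma i_lowstar_preenvelope X V U (v : homset (i_upshriek R X) V) (t : homset V U) :
  ses v t -> exists X' (c : homset X X') (p : homset X' (i_lowstar R U)),
    [/\ ses c p, iso_ob V (i_upshriek R X') & iso_ob (j_upstar R X) (j_upstar R X')].
Proof.
move=> s; have [eta [eps uc]] := adjoint_unit_counit (i_adj2 R).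
have [X' [c [p [scp iV]]]] :=
  glue_preenvelope uc abA abB i_lowstar_exact exi (i_lowstar_ff R) s.
exists X', c, p; split=> //; exists (fmap (j_upstar R) c).
apply: (ses_zero_iso abC (j_upstar_exact scp)); exact: j_upstar_i_lowstar.
Qed.

Lemma j_lowshriek_preenvelope X V U (v : homset (j_upstar R X) V) (t : homset V U) :
  ses v t -> exists X' (c : homset X X') (p : homset X' (j_lowshriek R U)),
    ses c p /\ iso_ob V (j_upstar R X').
Proof.
move=> s; have [eta [eps uc]] := adjoint_unit_counit (j_adj1 R).
exact: (glue_preenvelope uc abC abB exj j_upstar_exact (j_lowshriek_ff R) s).
Qed.

End Recollement.

(** * Glueing *)

Section Glueing.
Variables (k : fieldType) (A B C : linCat k).
Hypotheses (abA : abelian_cat A) (abB : abelian_cat B) (abC : abelian_cat C).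
Variable R : recollement A B C.
Hypotheses (EPB : enough_projectives B) (EIB : enough_injectives B).
Hypotheses (exi : exact_functor (i_upshriek R)) (exj : exact_functor (j_lowshriek R)).
Variables (U1 V1 : A -> Prop) (U3 V3 : C -> Prop).
Hypotheses (tilt1 : tilting_cotorsion_pair U1 V1) (tilt3 : tilting_cotorsion_pair U3 V3).

Let EPA := enough_projectivesA abA abB R EPB.
Let EPC := enough_projectivesC abB EPB exi.
Let EIA := enough_injectivesA abA abB EIB exi.
Let EIC := enough_injectivesC abB abC EIB exj.
Let cot1 : cotorsion_pair U1 V1. Proof. by case: tilt1. Qed.
Let cot3 : cotorsion_pair U3 V3. Proof. by case: tilt3. Qed.
Let sV1 : is_subcat V1. Proof. by case: cot1. Qed.
Let sV3 : is_subcat V3. Proof. by case: cot3. Qed.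

Let U2 := glued_U R V1 V3.
Let V2 := glued_V R V1 V3.

Lemma glued_UP X : U2 X <-> (forall Y, V2 Y -> extv 0 X Y).
Proof. exact: left_perp1P. Qed.

Lemma glued_V_subcat : is_subcat V2.
Proof.
split.
- move=> X Y [f isof] [VX WX]; split.
    exact: (subcat_iso sV1 (is_iso_ob (fmap_iso _ isof))).
  exact: (subcat_iso sV3 (is_iso_ob (fmap_iso _ isof))).
- move=> n F S H dS; split.
    by case: sV1 => _ ds _; apply: ds (fmap_dsum _ dS) => i; case: (H i).
  by case: sV3 => _ ds _; apply: ds (fmap_dsum _ dS) => i; case: (H i).
move=> X Y [X' d] [VY WY]; split.
  by case: sV1 => _ _ sm; apply: sm VY; exists (i_upshriek R X'); apply: fmap_dsum2.
by case: sV3 => _ _ sm; apply: sm WY; exists (j_upstar R X'); apply: fmap_dsum2.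
Qed.

Lemma glued_U_subcat : is_subcat U2.
Proof.
split.
- move=> X Y iXY /glued_UP H; apply/glued_UP => W VW.
  by apply: (extv0_retract abB (iso_retract iXY)); apply: H.
- move=> n F S H dS; apply/glued_UP => W VW.
  by apply: (extv0_dsum abB dS) => i; have /glued_UP := H i; apply.
move=> X Y /summand_retract rXY /glued_UP H; apply/glued_UP => W VW.
by apply: (extv0_retract abB rXY); apply: H.
Qed.

Lemma glued_U_i_lowstar M : U1 M -> U2 (i_lowstar R M).
Proof.
move=> UM; apply/glued_UP => Y [VY _]; apply/extv_i_lowstar => //.
exact: (cotorsion_extv0 abA EPA EIA cot1).
Qed.

Lemma glued_U_j_lowshriek N : U3 N -> U2 (j_lowshriek R N).
Proof.
move=> UN; apply/glued_UP => Y [_ VY]; apply/extv_j_lowshriek => //.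
exact: (cotorsion_extv0 abC EPC EIC cot3).
Qed.

Lemma glued_V_i_lowstar M : V1 M -> V2 (i_lowstar R M).
Proof.
move=> VM; split; last exact: (subcat_zero sV3 (j_upstar_i_lowstar R M)).
have [eta [isoeta _]] := i_lowstar_unit R M.
exact: (subcat_iso sV1 (is_iso_ob isoeta)).
Qed.

Lemma glued_V_j_lowstar N : V3 N -> V2 (j_lowstar R N).
Proof.
move=> VN; split; first exact: (subcat_zero sV1 (i_upshriek_j_lowstar R N)).
exact: (subcat_iso sV3 (iso_obC (j_lowstar_counit R N))).
Qed.

Lemma glued_U_extension X1 X X2 (f : homset X1 X) (g : homset X X2) :
  ses f g -> U2 X1 -> U2 X2 -> U2 X.
Proof.
move=> s /glued_UP H1 /glued_UP H2; apply/glued_UP => Y VY.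
by apply: (extv_extension abB EPB EIB s); [exact: H1 | exact: H2].
Qed.

(** The order matters: the j^* part is corrected first, because the later correction of the i^! part
    leaves j^* unchanged up to isomorphism. *)
Lemma glued_preenvelope X : exists V W M N (f : homset X V) (g : homset V W)
  (a : homset (j_lowshriek R N) W) (b : homset W (i_lowstar R M)),
  [/\ ses f g, ses a b, V2 V, U1 M & U3 N].
Proof.
have [_ _ _ _ /(_ (j_upstar R X)) [V [N [v [t [VV UN s]]]]]] := cot3.
have [X1 [c [p [scp iV]]]] := j_lowshriek_preenvelope abB abC exj s.
have [_ _ _ _ /(_ (i_upshriek R X1)) [V' [M [v' [t' [VV' UM s']]]]]] := cot1.
have [X2 [c' [p' [scp' iV' iX]]]] := i_lowstar_preenvelope abA abB abC exi s'.
have [W [b [a [w [sab sw _ _]]]]] := cokernel_comp_ses abB scp' scp.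
exists X2, W, M, N, (c' \oc c), w, a, b; split=> //; split.
  exact: subcat_iso iV' VV'.
exact: (subcat_iso sV3 iX (subcat_iso sV3 iV VV)).
Qed.

(** The pushout [Z] maps onto [X] with kernel [V] in [V2], so [X] is a retract of [Z]; and [Z] is
    built by extensions from a projective, some j_! N and some i_* M. It is used with [m = 0] for
    orthogonality and with a large [m] for the dimension bound. *)
Lemma glued_extv_ge m Y :
  (forall M i, U1 M -> (m <= i)%N -> extv i (i_lowstar R M) Y) ->
  (forall N i, U3 N -> (m <= i)%N -> extv i (j_lowshriek R N) Y) ->
  forall X i, U2 X -> (m <= i)%N -> extv i X Y.
Proof.
move=> H1 H3 X i /glued_UP UX mi.
have [P [p [pP ep]]] := EPB X; have [K [u su]] := epi_ses_ex abB ep.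
have [V [W [M [N [f [g [a [b [sfg sab VV UM UN]]]]]]]]] := glued_preenvelope K.
have [Z [c [q [d [h [scq sdh]]]]]] := pushout_ses2 abB su sfg.
have [s hs] := UX _ VV _ _ _ sdh.
apply: (extv_retract abB EPB EIB (Z := Z)); first by exists s, h.
apply: (extv_extension abB EPB EIB scq); first exact: projective_extv.
by apply: (extv_extension abB EPB EIB sab); [exact: H3 | exact: H1].
Qed.

Lemma glued_extv X Y i : U2 X -> V2 Y -> extv i X Y.
Proof.
move=> UX [V1Y V3Y]; apply: (glued_extv_ge (m := 0%N)) => // [M|N] j UM _.
  by apply/extv_i_lowstar => //; apply: (tilting_extv abA EPA EIA tilt1).
by apply/extv_j_lowshriek => //; apply: (tilting_extv abC EPC EIC tilt3).
Qed.

Lemma glued_bound : exists m, (0 < m)%N /\ forall X Y, U2 X -> extv m X Y.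
Proof.
have [m1 [m1gt H1]] := tilting_bound abA EPA EIA tilt1.
have [m3 [m3gt H3]] := tilting_bound abC EPC EIC tilt3.
exists (maxn m1 m3); rewrite leq_max m1gt; split=> // X Y UX.
apply: (glued_extv_ge (m := maxn m1 m3)) => // [M|N] j UM; rewrite geq_max => /andP[j1 j3].
  by apply/extv_i_lowstar => //; apply: H1.
by apply/extv_j_lowshriek => //; apply: H3.
Qed.

(** Precovers are obtained from preenvelopes of a syzygy by the classical trick of Salce. *)
Lemma glued_cotorsion_pair : cotorsion_pair U2 V2.
Proof.
split; [exact: glued_U_subcat | exact: glued_V_subcat | by move=> X Y; apply | |].
  move=> X; have [P [p [pP ep]]] := EPB X; have [K [u su]] := epi_ses_ex abB ep.
  have [V [W [M [N [f [g [a [b [sfg sab VV UM UN]]]]]]]]] := glued_preenvelope K.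
  have [Z [c [q [d [h [scq sdh]]]]]] := pushout_ses2 abB su sfg.
  exists V, Z, d, h; split=> //; apply: glued_U_extension scq _ _.
    by apply/glued_UP => Y _; apply: projective_extv0.
  apply: glued_U_extension sab _ _.
    exact: glued_U_j_lowshriek.
  exact: glued_U_i_lowstar.
move=> X; have [V [W [M [N [f [g [a [b [sfg sab VV UM UN]]]]]]]]] := glued_preenvelope X.
exists V, W, f, g; split=> //; apply: glued_U_extension sab _ _.
  exact: glued_U_j_lowshriek.
exact: glued_U_i_lowstar.
Qed.

Lemma glued_cap_i_lowstar M :
  subcat_cap U1 V1 M -> subcat_cap U2 V2 (i_lowstar R M).
Proof. by case=> UM VM; split; [exact: glued_U_i_lowstar | exact: glued_V_i_lowstar]. Qed.

(** Only the i^! part of j_! N needs correcting, since j^* j_! N is isomorphic to [N], already in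
    [V3]. *)
Lemma j_lowshriek_glued_cap N : subcat_cap U3 V3 N ->
  exists K M (c : homset (j_lowshriek R N) K) (p : homset K (i_lowstar R M)),
    [/\ ses c p, U1 M & subcat_cap U2 V2 K].
Proof.
move=> [UN VN].
have [_ _ _ _ /(_ (i_upshriek R (j_lowshriek R N))) [V [M [v [t [VV UM s]]]]]] := cot1.
have [K [c [p [scp iV iN]]]] := i_lowstar_preenvelope abA abB abC exi s.
exists K, M, c, p; split=> //; split.
  by apply: glued_U_extension scp _ _; [exact: glued_U_j_lowshriek | exact: glued_U_i_lowstar].
split; first exact: (subcat_iso sV1 iV).
have [eta [isoeta _]] := j_lowshriek_unit R N.
exact: (subcat_iso sV3 iN (subcat_iso sV3 (is_iso_ob isoeta) VN)).
Qed.

(** The i^! part is tested on i_* of the first tilting class. Knowing i^! X in [V1], all Ext from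
    i_* M to [X] vanish, so the vanishing for [K] descends to j_! N. *)
Lemma glued_right_perp X : right_perp (subcat_cap U2 V2) X -> V2 X.
Proof.
move/(right_perpP abB EPB EIB) => H.
have V1X : V1 (i_upshriek R X).
  apply/(tilting_rightP abA EPA EIA tilt1) => M capM i.
  by apply/extv_i_lowstar => //; apply: H; apply: glued_cap_i_lowstar.
split=> //; apply/(tilting_rightP abC EPC EIC tilt3) => N capN i.
have [K [M [c [p [s UM capK]]]]] := j_lowshriek_glued_cap capN.
apply/extv_j_lowshriek => //; apply: (extv_kernel abB EPB EIB s); first exact: H.
by apply/extv_i_lowstar => //; apply: (tilting_extv abA EPA EIA tilt1).
Qed.

(** j^* is left adjoint to the exact j_*, which maps [V3] into [V2]. *)
Lemma glued_U_j_upstar X : U2 X -> U3 (j_upstar R X).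
Proof.
move=> /glued_UP UX; apply: (cotorsion_left abC cot3) => N VN.
by apply: extv0_j_upstar => //; apply: UX; apply: glued_V_j_lowstar.
Qed.

Variables (T1 : A) (T3 : C).
Hypotheses (addT1 : subcat_eq (subcat_cap U1 V1) (add_closure T1))
  (addT3 : subcat_eq (subcat_cap U3 V3) (add_closure T3)).

(* Given Y in U2 /\ V2, lifts of the maps T3 -> j^*Y to K and a special
   precover T0 -> i^!Y yield an epimorphism onto Y from a finite direct sum of
   copies of K and i_*T0.  Its kernel lies in V2, so it splits. *)
Lemma glued_cap_add_closure K M (c : homset (j_lowshriek R T3) K)
  (p : homset K (i_lowstar R M)) T :
  ses c p -> U1 M -> subcat_cap U2 V2 K -> is_dsum2 K (i_lowstar R T1) T ->
  forall Y, subcat_cap U2 V2 Y -> add_closure T Y.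
Proof.
move=> scp UM [UK VK] [e1 [e2 [q1 [q2 [qe1 qe2 _ _ _]]]]] Y [UY [V1Y V3Y]].
have [eta3 [_ lift3]] := j_lowshriek_unit R T3.
pose kap := fmap (j_upstar R) c \oc eta3.
(* The transpose j_! T3 -> Y of [g] extends to [K], because Ext^1(i_* M, Y) = 0. *)
have ext3 (g : homset T3 (j_upstar R Y)) :
    exists h : homset K Y, fmap (j_upstar R) h \oc kap = g.
  have [h eh] := lift3 Y g.
  have /glued_UP /(_ Y (conj V1Y V3Y)) extM := glued_U_i_lowstar UM.
  have [h' eh'] := extv0_ext abB h extM scp.
  by exists h'; rewrite /kap compmA -fmap_comp eh'.
clearbody kap; have [lft lftE] := functional_choice _ ext3.
have [s es] : factors_through T3 (idmor (j_upstar R Y)).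
  by apply/add_closureP => //; apply/addT3; split=> //; apply: glued_U_j_upstar.
have [dsum _ _ _ _] := abB.
(* One copy of [K] for each pair in the factorization of the identity of j^* Y through [T3]; this
   makes j^* of [h] split epi. *)
have [D dD] := dsum (size s) (fun=> K).
have VD : V2 D by case: glued_V_subcat => _ ds _; apply: ds dD.
have [inj [prj [pi pni _]]] := dD.
pose t j := tnth (in_tuple s) j.
pose h : homset D Y := \sum_j lft (t j).2 \oc prj j.
pose sec : homset (j_upstar R Y) (j_upstar R D) :=
  \sum_j fmap (j_upstar R) (inj j) \oc kap \oc (t j).1.
have hsec : fmap (j_upstar R) h \oc sec = idmor (j_upstar R Y).
  rewrite es [RHS]big_tnth comp_sumr; apply: eq_bigr => j _.
  rewrite !compmA -fmap_comp comp_suml (bigD1 j) //= big1 => [|l lj].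
    by rewrite addr0 (comp_eq (pi j)) comp_idr lftE.
  by rewrite (comp_eq (pni _ _ lj)) comp0r.
have [_ _ _ /(_ (i_upshriek R Y)) [V [T0 [v [tau [VV UT0 sv]]]]] _] := cot1.
(* [T0] is an extension of i^! Y by [V], both in [V1]; being in [U1] too, it lies in [add T1]. *)
have VT0 : V1 T0 by apply: (cotorsion_right_extension abA EPA EIA cot1 sv).
have [eta1 [[r1 [r1e er1]] lift1]] := i_lowstar_unit R T0.
have [g ge] := lift1 Y tau.
have [Z [s1 [s2 [p1 [p2 [ps1 ps2 ps12 ps21 sps]]]]]] := dsum2_ex abB D (i_lowstar R T0).
have dZ : is_dsum2 D (i_lowstar R T0) Z by exists s1, s2, p1, p2.
have VZ : V2 Z.
  by apply: (subcat_dsum2 glued_V_subcat dZ) => //; apply: glued_V_i_lowstar.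
pose f := h \oc p1 + g \oc p2.
have fs1 : f \oc s1 = h by rewrite compDl -!compmA ps1 ps21 comp0r addr0 comp_idr.
have fs2 : f \oc s2 = g by rewrite compDl -!compmA ps2 ps12 comp0r add0r comp_idr.
have fsec : fmap (j_upstar R) f \oc (fmap (j_upstar R) s1 \oc sec) = idmor _.
  by rewrite compmA -fmap_comp fs1.
have ef : epi f.
  apply: (recollement_epi abB exi); last exact: epi_section fsec.
  apply: (@epi_compl _ _ _ _ _ _ (fmap (i_upshriek R) s2 \oc eta1)).
  by rewrite compmA -fmap_comp fs2 ge; exact: ses_epi sv.
have [L [z sz]] := epi_ses_ex abB ef.
(* j^* L is a retract of j^* Z as j^* f splits, while i^! L is an extension of i^! D by [V]. *)
have VL : V2 L.
  split; last first.
    have rL := split_kernel_retract (j_upstar_exact R sz).1 fsec.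
    by apply: (subcat_retract abC sV3 rL); case: VZ.
  have sv' : ses (eta1 \oc v) (fmap (i_upshriek R) f \oc fmap (i_upshriek R) s2).
    have -> : fmap (i_upshriek R) f \oc fmap (i_upshriek R) s2 = tau \oc r1.
      by rewrite -fmap_comp fs2 -ge -compmA er1 comp_idr.
    exact: iso_ses.
  have ip1 : fmap (i_upshriek R) p1 \oc fmap (i_upshriek R) s1 = idmor _.
    by rewrite -fmap_comp ps1 fmap_id.
  have ip2 : fmap (i_upshriek R) p2 \oc fmap (i_upshriek R) s2 = idmor _.
    by rewrite -fmap_comp ps2 fmap_id.
  have ip12 : fmap (i_upshriek R) p1 \oc fmap (i_upshriek R) s2 = 0.
    by rewrite -fmap_comp ps12 fmap0.
  have isp : fmap (i_upshriek R) s1 \oc fmap (i_upshriek R) p1 +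
      fmap (i_upshriek R) s2 \oc fmap (i_upshriek R) p2 = idmor _.
    by rewrite -!fmap_comp -fmapD sps fmap_id.
  have [d [_ sd]] := dsum2_kernel_ses abA ip1 ip2 ip12 isp sv' (exi sz).1.
  by apply: (cotorsion_right_extension abA EPA EIA cot1 sd) => //; case: VD.
have /glued_UP /(_ L VL) splitY := UY.
have [w fw] := splitY _ _ _ sz.
(* The section [w] writes the identity of [Y] as a map through copies of [K] plus a map through i_*
   T0; both factor through sums of copies of [T]. *)
apply/add_closureP => //; rewrite -fw compDl; apply: factors_throughD.
  rewrite -compmA comp_suml; apply: factors_through_sum => j.
  have -> : lft (t j).2 \oc prj j \oc (p1 \oc w) =
      lft (t j).2 \oc q1 \oc (e1 \oc (prj j \oc (p1 \oc w))).
    by rewrite !compmA (comp_eq qe1) comp_idr.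
  exact: factors_throughI.
have [s0 es0] : factors_through T1 (idmor T0).
  by apply/add_closureP => //; apply/addT1.
rewrite -compmA -[p2 \oc w]comp_idl -(fmap_id (i_lowstar R)) es0 fmap_sum comp_suml comp_sumr.
apply: factors_through_sum => x.
have -> : g \oc (fmap (i_lowstar R) (x.2 \oc x.1) \oc (p2 \oc w)) =
    g \oc fmap (i_lowstar R) x.2 \oc q2 \oc (e2 \oc (fmap (i_lowstar R) x.1 \oc (p2 \oc w))).
  by rewrite fmap_comp !compmA (comp_eq qe2) comp_idr.
exact: factors_throughI.
Qed.

Lemma glued_cap_add : exists T, subcat_eq (subcat_cap U2 V2) (add_closure T).
Proof.
have capT3 : subcat_cap U3 V3 T3 by apply/addT3; apply: add_closure_self.
have capT1 : subcat_cap U1 V1 T1 by apply/addT1; apply: add_closure_self.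
have [K [M [c [p [s UM capK]]]]] := j_lowshriek_glued_cap capT3.
have [T dT] := dsum2_ex abB K (i_lowstar R T1).
exists T => X; split; first by move=> capX; exact: (glued_cap_add_closure s UM capK dT capX).
have sc := is_subcat_cap glued_U_subcat glued_V_subcat.
apply: add_closure_min => //; apply: (subcat_dsum2 sc dT) => //.
exact: glued_cap_i_lowstar.
Qed.

End Glueing.

Theorem theorem1p4 (k : fieldType) (A B C : linCat k)
  (abA : abelian_cat A) (abB : abelian_cat B) (abC : abelian_cat C)
  (ksA : krull_schmidt A) (ksB : krull_schmidt B) (ksC : krull_schmidt C)
  (R : recollement A B C)
  (projB : enough_projectives B) (injB : enough_injectives B)
  (i_upshriek_exact : exact_functor (i_upshriek R))
  (j_lowshriek_exact : exact_functor (j_lowshriek R))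
  (U1 V1 : A -> Prop) (U3 V3 : C -> Prop)
  (tilt1 : tilting_cotorsion_pair U1 V1)
  (tilt3 : tilting_cotorsion_pair U3 V3)
  (T1 : A) (T3 : C)
  (addT1 : subcat_eq (subcat_cap U1 V1) (add_closure T1))
  (addT3 : subcat_eq (subcat_cap U3 V3) (add_closure T3)) :
  tilting_cotorsion_pair (glued_U R V1 V3) (glued_V R V1 V3) /\
  exists (n : nat) (T : B),
    n_tilting_object n T /\
    subcat_eq (subcat_cap (glued_U R V1 V3) (glued_V R V1 V3)) (add_closure T).
Proof.
have [m [m0 bd]] := glued_bound abA abB abC projB injB i_upshriek_exact j_lowshriek_exact tilt1 tilt3.
have cot := glued_cotorsion_pair abA abB abC projB injB i_upshriek_exact j_lowshriek_exact tilt1 tilt3.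
have [] := bounded_tilting abB projB injB cot m0 _ bd.
- move=> X Y i.
  exact: (glued_extv abA abB abC projB injB i_upshriek_exact j_lowshriek_exact tilt1 tilt3).
- exact: (glued_right_perp abA abB abC projB injB i_upshriek_exact j_lowshriek_exact tilt1 tilt3).
move=> tilt nt; split=> //.
have [T eT] := glued_cap_add abA abB abC projB injB i_upshriek_exact j_lowshriek_exact
  tilt1 tilt3 addT1 addT3.
(* The integer is the common bound [m]; being [m]-tilting transfers along the pointwise equivalence
   of the two subcategories. *)
by exists m, T; split=> //; apply: n_tilting_eq eT nt.
Qed.
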